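(* Let $K$ be an algebraically closed field and $\alpha\ge 0$ an integer. The map $g\mapsto(\chi_g,\Xi_g)$ is an isomorphism of semigroups from $[\mathrm{Coll}_\infty(\alpha)]$ (with the $\circ$-multiplication) onto $R_\alpha$, where $R_\alpha\subset\Gamma_\alpha\times\Delta$ is the subsemigroup consisting of pairs $(\chi,\Xi)$ such that the divisor of the denominator of $\det\chi(\lambda)$ is contained in the divisor $\Xi$.
   Context: Write elements of $\mathrm{Mat}(\alpha+N,K)$ as block matrices $g=\begin{pmatrix} a & b \\ c & d \end{pmatrix}$ with $a$ of size $\alpha\times\alpha$ and $d$ of size $N\times N$. The group $\mathrm{GL}(N,K)$ acts by conjugation by the matrices $\begin{pmatrix} 1_\alpha & 0 \\ 0 & u \end{pmatrix}$, $u\in \mathrm{GL}(N,K)$. Denote by $[\mathrm{Coll}_N(\alpha)]$ the categorical quotient, i.e. the spectrum of the algebra of $\mathrm{GL}(N,K)$-invariant polynomials on $\mathrm{Mat}(\alpha+N,K)$. Product: for $g=\begin{pmatrix} a & b \\ c & d \end{pmatrix}\in\mathrm{Mat}(\alpha+N_1,K)$ and $h=\begin{pmatrix} p & q \\ r & t \end{pmatrix}\in\mathrm{Mat}(\alpha+N_2,K)$ set $g\circ h=\begin{pmatrix} ap & b & aq \\ cp & d & cq \\ r & 0 & t \end{pmatrix}\in \mathrm{Mat}(\alpha+N_1+N_2,K)$. This induces an operation $[\mathrm{Coll}_{N_1}(\alpha)]\times[\mathrm{Coll}_{N_2}(\alpha)]\to[\mathrm{Coll}_{N_1+N_2}(\alpha)]$.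 The maps $\begin{pmatrix} a & b \\ c & d \end{pmatrix}\mapsto\begin{pmatrix} a & b & 0 \\ c & d & 0 \\ 0 & 0 & 1 \end{pmatrix}$ induce embeddings $[\mathrm{Coll}_N(\alpha)]\to[\mathrm{Coll}_{N+1}(\alpha)]$; $[\mathrm{Coll}_\infty(\alpha)]$ is the inductive limit, with the induced associative $\circ$-multiplication. Characteristic function: $\chi_g(\lambda)=a+\lambda b(1-\lambda d)^{-1}c$, a rational function of $\lambda$ with values in $\mathrm{Mat}(\alpha,K)$. For $g\in \mathrm{Mat}(\alpha+N,K)$ the exceptional divisor (a finite set with multiplicities) in the projective line $\mathbb P K^1$ is the divisor of zeros of $p_g(\lambda)=\det(1-\lambda d)$ plus the point $\lambda=\infty$ with multiplicity $N-\deg p_g$. For an element of $[\mathrm{Coll}_\infty(\alpha)]$ represented by $g\in \mathrm{Mat}(\alpha+N,K)$, its characteristic function is $\chi_g$, and its divisor $\Xi_g$ is the exceptional divisor of the matrix $g$ plus the point $\lambda=1$ with multiplicity $\infty$. $\Gamma_\alpha$ is the semigroup (under pointwise matrix multiplication) of rational maps $\chi:\mathbb PK^1\to\mathrm{Mat}(\alpha,K)$ regular at the point $\lambda=0$. $\Delta$ is the set, equipped with the operation of addition, of all ''divisors'', i.e. functions $\xi:\mathbb PK^1\to\mathbb Z_{\ge0}\cup\{\infty\}$ such that $\xi(\lambda)=0$ for all but a finite number of $\lambda$, $\xi(1)=\infty$, and $\xi$ is finite at all other points.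
   Formalization: In R_α the formal theorem also requires Ξ(0)=0, and bounds by Ξ the pole divisors of all minors of χ (the denominator of det χ before cancellation), not only of det χ in lowest terms; with the literal R_α the map is not onto. *)

(* Defs.v *)
From HB Require Import structures.
From mathcomp Require Import all_boot all_order all_algebra.
From mathcomp Require Import generic_quotient fraction.
From mathcomp Require Import boolp.
From mathcomp Require Import mpoly.

Set Implicit Arguments.
Unset Strict Implicit.
Unset Printing Implicit Defensive.

Import GRing.Theory.
Local Open Scope ring_scope.
Local Open Scope quotient_scope.

Section MatrixOps.
Variable R : pzRingType.
Variable alpha : nat.

(* Conjugation by diag(1, u) when v is the inverse of u. *)
Definition coll_conj N (u v : 'M[R]_N) (g : 'M[R]_(alpha + N)) :
    'M[R]_(alpha + N) :=
  block_mx 1%:M 0 0 u *m g *m block_mx 1%:M 0 0 v.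

Definition coll_mul N1 N2 (g : 'M[R]_(alpha + N1)) (h : 'M[R]_(alpha + N2)) :
    'M[R]_(alpha + (N1 + N2)) :=
  let: (a, b, c, d) := (ulsubmx g, ursubmx g, dlsubmx g, drsubmx g) in
  let: (p, q, r, t) := (ulsubmx h, ursubmx h, dlsubmx h, drsubmx h) in
  block_mx (a *m p)                    (row_mx b (a *m q))
           (col_mx (c *m p) r) (block_mx d (c *m q)
                                         0 t).

Definition coll_emb N (g : 'M[R]_(alpha + N)) : 'M[R]_(alpha + (N + 1)) :=
  let: (a, b, c, d) := (ulsubmx g, ursubmx g, dlsubmx g, drsubmx g) in
  block_mx a              (row_mx b 0)
           (col_mx c 0) (block_mx d 0
                                  0 1%:M).

Lemma coll_mul_conjl N1 N2 (u v : 'M[R]_N1) g (h : 'M[R]_(alpha + N2)) :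
  coll_mul (coll_conj u v g) h =
  coll_conj (block_mx u 0 0 1%:M) (block_mx v 0 0 1%:M) (coll_mul g h).
Proof.
rewrite -[g]submxK -[h]submxK /coll_conj /coll_mul /=.
rewrite !(mulmx_block, block_mxKul, block_mxKur, block_mxKdl, block_mxKdr).
rewrite !(mul1mx, mulmx1, mul0mx, mulmx0, addr0, add0r).
rewrite !mulmx_block !(mul_row_block, mul_block_col).
by rewrite !(mul1mx, mulmx1, mul0mx, mulmx0, addr0, add0r, mulmxA).
Qed.

Lemma coll_mul_conjr N1 N2 (u v : 'M[R]_N2) (g : 'M[R]_(alpha + N1)) h :
  coll_mul g (coll_conj u v h) =
  coll_conj (block_mx 1%:M 0 0 u) (block_mx 1%:M 0 0 v) (coll_mul g h).
Proof.
rewrite -[g]submxK -[h]submxK /coll_conj /coll_mul /=.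
rewrite !(mulmx_block, block_mxKul, block_mxKur, block_mxKdl, block_mxKdr).
rewrite !(mul1mx, mulmx1, mul0mx, mulmx0, addr0, add0r).
rewrite !mulmx_block !(mul_row_block, mul_block_col).
by rewrite !(mul1mx, mulmx1, mul0mx, mulmx0, addr0, add0r, mulmxA).
Qed.

Lemma coll_emb_conj N (u v : 'M[R]_N) g :
  coll_emb (coll_conj u v g) =
  coll_conj (block_mx u 0 0 1%:M) (block_mx v 0 0 1%:M) (coll_emb g).
Proof.
rewrite -[g]submxK /coll_conj /coll_emb /=.
rewrite !(mulmx_block, block_mxKul, block_mxKur, block_mxKdl, block_mxKdr).
rewrite !(mul1mx, mulmx1, mul0mx, mulmx0, addr0, add0r).
rewrite !mulmx_block !(mul_row_block, mul_block_col).
by rewrite !(mul1mx, mulmx1, mul0mx, mulmx0, addr0, add0r).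
Qed.

End MatrixOps.

Section MapOps.
Variables (R S : pzRingType) (f : {rmorphism R -> S}) (alpha : nat).

Lemma map_coll_mul N1 N2 (g : 'M[R]_(alpha + N1)) (h : 'M[R]_(alpha + N2)) :
  map_mx f (coll_mul g h) = coll_mul (map_mx f g) (map_mx f h).
Proof.
rewrite -[g]submxK -[h]submxK /coll_mul /=.
rewrite !(map_block_mx, block_mxKul, block_mxKur, block_mxKdl, block_mxKdr).
by rewrite !(map_row_mx, map_col_mx, map_mxM, map_mx0).
Qed.

Lemma map_coll_emb N (g : 'M[R]_(alpha + N)) :
  map_mx f (coll_emb g) = coll_emb (map_mx f g).
Proof.
rewrite -[g]submxK /coll_emb /=.
rewrite !(map_block_mx, block_mxKul, block_mxKur, block_mxKdl, block_mxKdr).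
by rewrite !(map_row_mx, map_col_mx, map_mx0, map_mx1).
Qed.

End MapOps.

Lemma mmap_coll_mul (k : comNzRingType) (R : comNzRingType)
    (phi : {rmorphism k -> R}) alpha N1 N2 (g : 'M[R]_(alpha + N1))
    (f : {mpoly k[(alpha + (N1 + N2)) * (alpha + (N1 + N2))]}) :
  exists F : {mpoly R[(alpha + N2) * (alpha + N2)]}, forall h : 'M[k]__,
    mmap phi (mxvec (coll_mul g (map_mx phi h)) 0) f =
    F.@[fun i => phi (mxvec h 0 i)].
Proof.
pose C := @mpolyC ((alpha + N2) * (alpha + N2)) R.
pose X : 'M[{mpoly R[(alpha + N2) * (alpha + N2)]}]_(alpha + N2) :=
  \matrix_(i, j) 'X_(mxvec_index i j).
exists (mmap (C \o phi) (mxvec (coll_mul (map_mx C g) X) 0) f) => h.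
set w := fun i => phi _.
have -> : coll_mul g (map_mx phi h) =
          map_mx (meval w) (coll_mul (map_mx C g) X).
  rewrite map_coll_mul; congr coll_mul; apply/matrixP => i j.
    by rewrite !mxE [RHS]mevalC.
  by rewrite !mxE [RHS]mevalXU /w mxvecE.
move: (coll_mul _ _) => B.
rewrite /mmap raddf_sum /=; apply: eq_bigr => m _.
rewrite mevalM mevalC; congr (_ * _); rewrite /mmap1 rmorph_prod /=.
by apply: eq_bigr => i _; rewrite rmorphXn /= -map_mxvec mxE.
Qed.

Section VanishingPolynomials.
Variable K : closedFieldType.

Lemma poly_eq0_horner (p : {poly K}) : (forall x, p.[x] = 0) -> p = 0.
Proof.
move=> p0; apply/eqP; apply: contraT => pN0.
have /closed_rootP [x] : size (p * 'X + 1%:P) != 1%N.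
  rewrite size_MXaddC (negPf pN0) /= eqSS size_poly_eq0.
  exact: pN0.
by rewrite /root !hornerE p0 mul0r add0r oner_eq0.
Qed.

Lemma mpoly_eq0_meval n (p : {mpoly K[n]}) : (forall v, p.@[v] = 0) -> p = 0.
Proof.
elim: n p => [|n IHn] p p0.
  apply/mpolyP => m; rewrite mcoeff0; move: (p0 (fun=> 0)); rewrite mevalE.
  under eq_bigr do rewrite big_ord0 mulr1.
  move=> s0; have mE m' : m' = m by apply/mnmP; case.
  have [|/memN_msupp_eq0 //] := boolP (m \in msupp p) => mp.
  rewrite (bigD1_seq m) //= in s0.
  by rewrite big1 ?addr0 // in s0 => m' /eqP; case.
pose low (m : 'X_{1..n.+1}) : 'X_{1..n} :=
  [multinom m (widen_ord (leqnSn n) i) | i < n].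
pose q k := \sum_(m <- msupp p | m ord_max == k) p@_m *: 'X_[low m].
have q0 k : q k = 0.
  apply: IHn => v.
  pose P := \sum_(m <- msupp p)
     (p@_m * \prod_(i < n) v i ^+ low m i) *: 'X^(m ord_max) : {poly K}.
  have P0 : P = 0.
    apply: poly_eq0_horner => x.
    pose w (i : 'I_n.+1) := if unlift ord_max i is Some j then v j else x.
    rewrite -(p0 w) mevalE horner_sum; apply: eq_bigr => m _.
    rewrite hornerZ hornerXn big_ord_recr /= mulrA; congr (_ * _ * _).
      apply: eq_bigr => i _; rewrite mnmE /w.
      have -> : widen_ord (leqnSn n) i = lift ord_max i.
        by apply: val_inj; rewrite /= /bump leqNgt ltn_ord.
      by rewrite liftK.
    by rewrite /w unlift_none.
  have := congr1 (fun r : {poly K} => r`_k) P0.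
  rewrite coef0 coef_sum => <-.
  rewrite /q raddf_sum /= [LHS]big_mkcond; apply: eq_bigr => m _.
  rewrite coefZ coefXn [k == _]eq_sym; case: eqP => _; last by rewrite mulr0.
  by rewrite mulr1 mevalZ mevalX.
apply/mpolyP => m; rewrite mcoeff0.
have [mp|/memN_msupp_eq0 //] := boolP (m \in msupp p).
have := congr1 (mcoeff (low m)) (q0 (m ord_max)).
rewrite mcoeff0 /q raddf_sum /= big_mkcond (bigD1_seq m) //= eqxx.
rewrite mcoeffZ mcoeffX eqxx mulr1 big1 ?addr0 // => m' Nm.
case: eqP => // mm.
rewrite mcoeffZ mcoeffX; case: eqP => [lowE|_]; last by rewrite mulr0.
case/eqP: Nm; apply/mnmP => i;  case: (unliftP ord_max i) => [j ->|-> //].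
have := congr1 (fun t : 'X_{1..n} => t j) lowE; rewrite !mnmE.
suff -> : widen_ord (leqnSn n) j = lift ord_max j by [].
by apply: val_inj; rewrite /= /bump leqNgt ltn_ord.
Qed.

End VanishingPolynomials.

(* K[Mat(n, K)]: the variable of index [mxvec_index i j] is the entry (i, j). *)
Notation mxpol K n := {mpoly K[(n * n)%N]}.

Section PolynomialsOnMatrices.
Variable K : closedFieldType.

Definition mxval n (g : 'M[K]_n) (f : mxpol K n) : K := f.@[mxvec g 0].
HB.instance Definition _ n g :=
  GRing.RMorphism.copy (@mxval n g) (meval (mxvec g 0)).

Definition genmx n : 'M[mxpol K n]_n := \matrix_(i, j) 'X_(mxvec_index i j).

(* The polynomial f(A), where the entries of A are polynomials on Mat(n, K). *)
Definition mxsubst m n (A : 'M[mxpol K n]_m) (f : mxpol K m) : mxpol K n :=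
  mmap (@mpolyC (n * n) K) (mxvec A 0) f.
HB.instance Definition _ m n A :=
  GRing.RMorphism.copy (@mxsubst m n A) (mmap (@mpolyC (n * n) K) (mxvec A 0)).

Lemma mxvalZ n c (f : mxpol K n) g : mxval g (c *: f) = c * mxval g f.
Proof. exact: mevalZ. Qed.

Lemma mxval_inj n (f1 f2 : mxpol K n) : (forall g, mxval g f1 = mxval g f2) -> f1 = f2.
Proof.
move=> f12; apply/eqP; rewrite -subr_eq0; apply/eqP.
apply: mpoly_eq0_meval => v; rewrite mevalB.
pose g : 'M[K]_n := vec_mx (\row_i v i).
have vE : v =1 mxvec g 0 by move=> i; rewrite vec_mxK mxE.
by rewrite !(meval_eq _ vE) -!/(mxval g _) f12 subrr.
Qed.

Lemma mxval_genmx n (g : 'M[K]_n) : map_mx (mxval g) (genmx n) = g.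
Proof. by apply/matrixP => i j; rewrite !mxE /mxval mevalXU mxvecE. Qed.

Lemma mxval_subst m n (A : 'M[mxpol K n]_m) f g :
  mxval g (mxsubst A f) = mxval (map_mx (mxval g) A) f.
Proof.
rewrite /mxval /mxsubst [RHS]mevalE raddf_sum /=; apply: eq_bigr => k _.
rewrite mevalM mevalC; congr (_ * _); rewrite /mmap1 rmorph_prod /=.
by apply: eq_bigr => i _; rewrite rmorphXn -map_mxvec mxE.
Qed.

Lemma mxsubstZ m n (A : 'M[mxpol K n]_m) c f :
  mxsubst A (c *: f) = c *: mxsubst A f.
Proof. by apply: mxval_inj => g; rewrite mxvalZ !mxval_subst mxvalZ. Qed.

End PolynomialsOnMatrices.

Section InvariantAlgebra.
Variables (K : closedFieldType) (alpha N : nat).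

Definition coll_inv : {pred mxpol K (alpha + N)} := fun f =>
  `[< forall (u : 'M[K]_N) (g : 'M[K]_(alpha + N)), u \in unitmx ->
        mxval (coll_conj u (invmx u) g) f = mxval g f >].

Lemma coll_invP f :
  reflect (forall u g, u \in unitmx ->
             mxval (coll_conj u (invmx u) g) f = mxval g f)
          (f \in coll_inv).
Proof. exact: asboolP. Qed.

Lemma coll_inv_subalg_closed : GRing.subalg_closed coll_inv.
Proof.
split; first by apply/coll_invP => u g _; rewrite !rmorph1.
  move=> c f1 f2 /coll_invP inv1 /coll_invP inv2; apply/coll_invP => u g uU.
  by rewrite !rmorphD /= !mxvalZ inv1 ?inv2.
move=> f1 f2 /coll_invP inv1 /coll_invP inv2; apply/coll_invP => u g uU.
by rewrite !rmorphM /= inv1 ?inv2.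
Qed.
HB.instance Definition _ :=
  GRing.isSubalgClosed.Build K (mxpol K (alpha + N)) coll_inv
    coll_inv_subalg_closed.

Record inv_alg := InvAlg {
  inv_val : mxpol K (alpha + N);
  _ : inv_val \in coll_inv }.
HB.instance Definition _ := [isSub for inv_val].
HB.instance Definition _ := [Choice of inv_alg by <:].
HB.instance Definition _ := [SubChoice_isSubAlgebra of inv_alg by <:].

Lemma inv_valE (f : inv_alg) u g :
  u \in unitmx ->
  mxval (coll_conj u (invmx u) g) (inv_val f) = mxval g (inv_val f).
Proof. by case: f => f /coll_invP /= fP; apply: fP. Qed.

Lemma inv_alg_eq (f1 f2 : inv_alg) :
  (forall g, mxval g (inv_val f1) = mxval g (inv_val f2)) -> f1 = f2.
Proof. by move=> f12; apply/val_inj/mxval_inj. Qed.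

Definition inv_eval (g : 'M[K]_(alpha + N)) (f : inv_alg) : K^o :=
  mxval g (inv_val f).

Lemma inv_eval_is_linear g : linear (inv_eval g).
Proof. by move=> c f1 f2; rewrite /inv_eval !(linearD, rmorphD) /= mxvalZ. Qed.
HB.instance Definition _ g :=
  GRing.isLinear.Build K inv_alg K^o _ (inv_eval g) (inv_eval_is_linear g).

Lemma inv_eval_is_multiplicative g : monoid_morphism (inv_eval g).
Proof.
by split=> [|f1 f2]; rewrite /inv_eval ?(rmorph1, rmorphM) //=.
Qed.
HB.instance Definition _ g :=
  GRing.isMonoidMorphism.Build inv_alg K^o (inv_eval g)
    (inv_eval_is_multiplicative g).

(* [Coll_N(alpha)]: since K is algebraically closed, the (closed) points of the
   spectrum of the algebra of invariants are its K-algebra morphisms to K. *)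
Definition coll_quot := {lrmorphism inv_alg -> K^o}.

Definition coll_point (g : 'M[K]_(alpha + N)) : coll_quot :=
  [the {lrmorphism inv_alg -> K^o} of inv_eval g].

End InvariantAlgebra.

Section LimitAndProduct.
Variables (K : closedFieldType) (alpha : nat).
Notation inv_alg := (inv_alg K alpha).
Notation coll_quot := (coll_quot K alpha).

Lemma block_diag_unitl N1 N2 (u : 'M[K]_N1) :
  u \in unitmx -> (block_mx u 0 0 1%:M : 'M_(N1 + N2)) \in unitmx.
Proof. by move=> uU; rewrite unitmxE det_ublock det1 mulr1 -unitmxE. Qed.

Lemma block_diag_unitr N1 N2 (u : 'M[K]_N2) :
  u \in unitmx -> (block_mx 1%:M 0 0 u : 'M_(N1 + N2)) \in unitmx.
Proof. by move=> uU; rewrite unitmxE det_ublock det1 mul1r -unitmxE. Qed.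

Lemma inv_val_conjl N1 N2 (f : inv_alg (N1 + N2)) (u : 'M[K]_N1) g :
  u \in unitmx ->
  mxval (coll_conj (block_mx u 0 0 1%:M) (block_mx (invmx u) 0 0 1%:M) g)
    (inv_val f) = mxval g (inv_val f).
Proof.
move=> uU; have U := block_diag_unitl N2 uU.
by rewrite -(inv_valE f g U) invmx_block_diag ?invmx1.
Qed.

Lemma inv_val_conjr N1 N2 (f : inv_alg (N1 + N2)) (u : 'M[K]_N2) g :
  u \in unitmx ->
  mxval (coll_conj (block_mx 1%:M 0 0 u) (block_mx 1%:M 0 0 (invmx u)) g)
    (inv_val f) = mxval g (inv_val f).
Proof.
move=> uU; have U := block_diag_unitr N1 uU.
by rewrite -(inv_valE f g U) invmx_block_diag ?invmx1.
Qed.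

Definition emb_pol N (f : inv_alg (N + 1)) : mxpol K (alpha + N) :=
  mxsubst (coll_emb (genmx K (alpha + N))) (inv_val f).

Lemma mxval_emb_pol N (f : inv_alg (N + 1)) g :
  mxval g (emb_pol f) = mxval (coll_emb g) (inv_val f).
Proof. by rewrite mxval_subst map_coll_emb mxval_genmx. Qed.

Lemma emb_pol_inv N (f : inv_alg (N + 1)) : emb_pol f \in @coll_inv K alpha N.
Proof.
apply/coll_invP => u g uU.
by rewrite !mxval_emb_pol coll_emb_conj inv_val_conjl.
Qed.

(* f |-> f o coll_emb *)
Definition emb_comorphism N (f : inv_alg (N + 1)) : inv_alg N :=
  InvAlg (emb_pol_inv f).

Lemma emb_comorphism_is_linear N : linear (@emb_comorphism N).
Proof.
move=> c f1 f2; apply: inv_alg_eq => g.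
by rewrite /= mxval_emb_pol !(linearD, rmorphD) /= !mxvalZ !mxval_emb_pol.
Qed.
HB.instance Definition _ N :=
  GRing.isLinear.Build K (inv_alg (N + 1)) (inv_alg N) _ (@emb_comorphism N)
    (@emb_comorphism_is_linear N).

Lemma emb_comorphism_is_multiplicative N : monoid_morphism (@emb_comorphism N).
Proof.
split=> [|f1 f2]; apply: inv_alg_eq => g.
  by rewrite /= mxval_emb_pol !rmorph1.
by rewrite /= mxval_emb_pol !rmorphM /= !mxval_emb_pol.
Qed.
HB.instance Definition _ N :=
  GRing.isMonoidMorphism.Build (inv_alg (N + 1)) (inv_alg N)
    (@emb_comorphism N) (@emb_comorphism_is_multiplicative N).

Definition coll_quot_emb N (phi : coll_quot N) : coll_quot (N + 1) :=
  [the {lrmorphism inv_alg (N + 1) -> K^o} of phi \o @emb_comorphism N].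

Lemma coll_quot_emb_point N (g : 'M[K]_(alpha + N)) :
  coll_quot_emb (coll_point g) =1 coll_point (coll_emb g).
Proof. by move=> f; rewrite /= /inv_eval /= mxval_emb_pol. Qed.

Section Slice.
Variables (N1 N2 : nat) (f : inv_alg (N1 + N2)).

Definition slice_pol (h : 'M[K]_(alpha + N2)) : mxpol K (alpha + N1) :=
  mxsubst (coll_mul (genmx K (alpha + N1)) (map_mx (@mpolyC _ K) h))
    (inv_val f).

Lemma mxval_slice_pol h g :
  mxval g (slice_pol h) = mxval (coll_mul g h) (inv_val f).
Proof.
rewrite mxval_subst map_coll_mul mxval_genmx -map_mx_comp; congr mxval.
congr coll_mul; apply/matrixP => i j; rewrite !mxE /=; exact: mevalC.
Qed.

Lemma slice_pol_inv h : slice_pol h \in @coll_inv K alpha N1.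
Proof.
apply/coll_invP => u g uU.
by rewrite !mxval_slice_pol coll_mul_conjl inv_val_conjl.
Qed.

(* g |-> f (g o h) *)
Definition slice h : inv_alg N1 := InvAlg (slice_pol_inv h).

Lemma mxval_slice h g :
  mxval g (inv_val (slice h)) = mxval (coll_mul g h) (inv_val f).
Proof. exact: mxval_slice_pol. Qed.

End Slice.

Section Product.
Variables N1 N2 : nat.

Lemma slice_conj (f : inv_alg (N1 + N2)) (u : 'M[K]_N2) h :
  u \in unitmx -> slice f (coll_conj u (invmx u) h) = slice f h.
Proof.
move=> uU; apply: inv_alg_eq => g.
by rewrite [LHS]mxval_slice [RHS]mxval_slice coll_mul_conjr inv_val_conjr.
Qed.

Lemma slice_expansion (f : inv_alg (N1 + N2)) :
  exists F : {mpoly {mpoly K[((alpha + N1) * (alpha + N1))%N]}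
                   [((alpha + N2) * (alpha + N2))%N]},
  forall h, slice_pol f h =
    \sum_(m <- msupp F) (\prod_i mxvec h 0 i ^+ m i) *: F@_m.
Proof.
have [F FE] := mmap_coll_mul (@mpolyC _ K) (genmx K (alpha + N1)) (inv_val f).
exists F => h; rewrite [LHS]FE.
rewrite mevalE; apply: eq_bigr => m _.
rewrite mulrC -mul_mpolyC rmorph_prod /=; congr (_ * _).
by apply: eq_bigr => i _; rewrite rmorphXn.
Qed.

Lemma mul_comorphism_ex (phi : coll_quot N1) (f : inv_alg (N1 + N2)) :
  exists F : inv_alg N2, forall h, mxval h (inv_val F) = phi (slice f h).
Proof.
have [F FE] := slice_expansion f.
have F_inv m : F@_m \in @coll_inv K alpha N1.
  apply/coll_invP => u g uU; apply/eqP; rewrite -subr_eq0; apply/eqP.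
  pose d m' := mxval (coll_conj u (invmx u) g) F@_m' - mxval g F@_m'.
  rewrite -/(d m).
  pose p := \sum_(m' <- msupp F) d m' *: 'X_[m'].
  have p0 : p = 0.
    apply: mxval_inj => h; rewrite rmorph0 raddf_sum /=.
    have := inv_valE (slice f h) g uU => /= /eqP.
    rewrite -subr_eq0 FE !rmorph_sum /= -sumrB => /eqP sum0.
    rewrite -[RHS]sum0; apply: eq_bigr => m' _.
    by rewrite !mxvalZ -mulrBr mulrC /mxval mevalX.
  have [mF|/memN_msupp_eq0 F0] := boolP (m \in msupp F); last first.
    by rewrite /d F0 !rmorph0 subr0.
  have := congr1 (mcoeff m) p0; rewrite mcoeff0 raddf_sum /= (bigD1_seq m) //=.
  rewrite mcoeffZ mcoeffX eqxx mulr1 big1 ?addr0 // => m' /negPf m'm.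
  by rewrite mcoeffZ mcoeffX m'm mulr0.
pose G : mxpol K (alpha + N2) :=
  \sum_(m <- msupp F) phi (InvAlg (F_inv m)) *: 'X_[m].
have GE h : mxval h G = phi (slice f h).
  have -> : slice f h =
      \sum_(m <- msupp F) (\prod_i mxvec h 0 i ^+ m i) *: InvAlg (F_inv m).
    apply: inv_alg_eq => g; rewrite -[RHS]/(inv_eval g _) [inv_val _]FE.
    rewrite rmorph_sum linear_sum; apply: eq_bigr => m _.
    by rewrite linearZ; apply: mxvalZ.
  rewrite !raddf_sum /=; apply: eq_bigr => m _.
  by rewrite mxvalZ linearZ /= mulrC /mxval mevalX.
have G_inv : G \in @coll_inv K alpha N2.
  by apply/coll_invP => u h uU; rewrite !GE slice_conj.
by exists (InvAlg G_inv).
Qed.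

(* For f in K[Mat(alpha + N1 + N2)]^GL, the invariant h |-> phi (f (_ o h)); the
   map f |-> f (_ o _) followed by phi (x) id on the tensor product of the two
   algebras of invariants. *)
Definition mul_comorphism phi f : inv_alg N2 :=
  projT1 (cid (mul_comorphism_ex phi f)).

Lemma mul_comorphismE phi f h :
  mxval h (inv_val (mul_comorphism phi f)) = phi (slice f h).
Proof. exact: (projT2 (cid (mul_comorphism_ex phi f))). Qed.

Lemma slice_is_linear h : linear (fun f : inv_alg (N1 + N2) => slice f h).
Proof.
move=> c f1 f2; apply: inv_alg_eq => g.
by rewrite mxval_slice !(linearD, rmorphD) /= !mxvalZ !mxval_slice_pol.
Qed.

Lemma mul_comorphism_is_linear phi : linear (mul_comorphism phi).
Proof.
move=> c f1 f2; apply: inv_alg_eq => h.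
rewrite mul_comorphismE slice_is_linear !(linearD, rmorphD) /=.
by rewrite linearZ /= mxvalZ !mul_comorphismE.
Qed.
HB.instance Definition _ phi :=
  GRing.isLinear.Build K (inv_alg (N1 + N2)) (inv_alg N2) _
    (mul_comorphism phi) (mul_comorphism_is_linear phi).

Lemma mul_comorphism_is_multiplicative phi :
  monoid_morphism (mul_comorphism phi).
Proof.
split=> [|f1 f2]; apply: inv_alg_eq => h.
  rewrite mul_comorphismE.
  have -> : slice (1 : inv_alg (N1 + N2)) h = 1.
    by apply: inv_alg_eq => g; rewrite mxval_slice !rmorph1.
  by rewrite !rmorph1.
rewrite [LHS]mul_comorphismE.
have -> : slice (f1 * f2) h = slice f1 h * slice f2 h.
  apply: inv_alg_eq => g; rewrite mxval_slice !rmorphM /=.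
  by rewrite !mxval_slice_pol.
by rewrite !rmorphM /= !mul_comorphismE.
Qed.
HB.instance Definition _ phi :=
  GRing.isMonoidMorphism.Build (inv_alg (N1 + N2)) (inv_alg N2)
    (mul_comorphism phi) (mul_comorphism_is_multiplicative phi).

Definition coll_quot_mul (phi : coll_quot N1) (psi : coll_quot N2) :
    coll_quot (N1 + N2) :=
  [the {lrmorphism inv_alg (N1 + N2) -> K^o} of psi \o mul_comorphism phi].

Lemma coll_quot_mul_point (g : 'M[K]_(alpha + N1)) (h : 'M[K]_(alpha + N2)) :
  coll_quot_mul (coll_point g) (coll_point h) =1 coll_point (coll_mul g h).
Proof.
by move=> f; rewrite /= /inv_eval mul_comorphismE /= /inv_eval mxval_slice.
Qed.

End Product.

Lemma coll_quot_eq N (phi psi : coll_quot N) : phi =1 psi -> phi = psi.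
Proof.
case: phi psi => [phi c1] [psi c2] /= /funext eq_phi.
case: _ / eq_phi c2 => c2; congr GRing.LRMorphism.Pack.
case: c1 => -[a1] [b1] [c1]; case: c2 => -[a2] [b2] [c2].
by rewrite (Prop_irrelevance a1 a2) (Prop_irrelevance b1 b2)
   (Prop_irrelevance c1 c2).
Qed.

Definition coll_rep := {N : nat & coll_quot N}.
HB.instance Definition _ := gen_eqMixin coll_rep.
HB.instance Definition _ := gen_choiceMixin coll_rep.

Definition coll_step (x : coll_rep) : coll_rep :=
  existT coll_quot (tag x + 1)%N (coll_quot_emb (tagged x)).

Definition coll_lim_rel : rel coll_rep := fun x y =>
  `[< exists i j, iter i coll_step x = iter j coll_step y >].

Lemma coll_lim_relP x y :
  reflect (exists i j, iter i coll_step x = iter j coll_step y)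
          (coll_lim_rel x y).
Proof. exact: asboolP. Qed.

Lemma coll_lim_rel_refl : reflexive coll_lim_rel.
Proof. by move=> x; apply/coll_lim_relP; exists 0%N, 0%N. Qed.

Lemma coll_lim_rel_sym : ssrbool.symmetric coll_lim_rel.
Proof.
by move=> x y; apply/coll_lim_relP/coll_lim_relP => -[i] [j] ij; exists j, i.
Qed.

Lemma coll_lim_rel_trans : transitive coll_lim_rel.
Proof.
move=> y x z /coll_lim_relP [i] [j] xy /coll_lim_relP [k] [l] yz.
apply/coll_lim_relP; exists (k + i)%N, (j + l)%N.
by rewrite !iterD xy -yz -!iterD addnC.
Qed.

Canonical coll_lim_equiv :=
  EquivRel coll_lim_rel coll_lim_rel_refl coll_lim_rel_sym coll_lim_rel_trans.

(* [Coll_oo(alpha)] *)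
Definition coll_lim := {eq_quot coll_lim_equiv}.

Definition coll_lim_in N (phi : coll_quot N) : coll_lim :=
  \pi_coll_lim (existT coll_quot N phi).

Definition coll_class N (g : 'M[K]_(alpha + N)) : coll_lim :=
  coll_lim_in (coll_point g).

(* The product computed on representatives chosen by [repr].  It is independent
   of the choice, i.e. [coll_lim_mul (coll_class g) (coll_class h)] is
   [coll_class (coll_mul g h)], because the injective map of the main statement
   is multiplicative both for [coll_mul] and for [coll_lim_mul]. *)
Definition coll_lim_mul (x y : coll_lim) : coll_lim :=
  coll_lim_in (coll_quot_mul (tagged (repr x)) (tagged (repr y))).

End LimitAndProduct.

Arguments coll_lim_mul {K alpha}.

Section CharacteristicFunction.
Variable K : closedFieldType.

Definition ratfun := {fraction {poly K}}.
HB.instance Definition _ := GRing.Field.on ratfun.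

Definition rat_const (c : K) : ratfun := tofrac c%:P.
Definition rat_lambda : ratfun := tofrac 'X.

Definition char_fun alpha N (g : 'M[K]_(alpha + N)) : 'M[ratfun]_alpha :=
  let: a := map_mx rat_const (ulsubmx g) in
  let: b := map_mx rat_const (ursubmx g) in
  let: c := map_mx rat_const (dlsubmx g) in
  let: d := map_mx rat_const (drsubmx g) in
  a + rat_lambda *: (b *m invmx (1%:M - rat_lambda *: d) *m c).

(* The projective line: [None] is the point at infinity. *)
Definition proj_line := option K.

(* The multiplicity of the point [x] in the denominator of [r], for [r] in
   lowest terms.  The subtraction is truncated, so that common factors of the
   representatives of [r] cancel and zeros of [r] do not count. *)
Definition den_mult (r : ratfun) (x : proj_line) : nat :=
  let n := \n_(repr r) in
  let d := \d_(repr r) in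
  if r == 0 then 0%N else
  match x with
  | Some a => (mup a d - mup a n)%N
  | None => ((size n).-1 - (size d).-1)%N
  end.

(* Z_{>= 0} with infinity, which is [None] *)
Definition natinf := option nat.

Definition addni (m n : natinf) : natinf :=
  match m, n with Some i, Some j => Some (i + j)%N | _, _ => None end.

Definition leni (m : nat) (n : natinf) : bool :=
  match n with Some i => (m <= i)%N | None => true end.

Definition divisor := proj_line -> natinf.

Definition div_add (xi1 xi2 : divisor) : divisor :=
  fun x => addni (xi1 x) (xi2 x).

Definition exc_poly alpha N (g : 'M[K]_(alpha + N)) : {poly K} :=
  \det (1%:M - 'X *: map_mx polyC (drsubmx g)).

Definition exc_div alpha N (g : 'M[K]_(alpha + N)) (x : proj_line) : nat :=
  match x with
  | Some a => mup a (exc_poly g)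
  | None => (N - (size (exc_poly g)).-1)%N
  end.

Definition coll_div alpha N (g : 'M[K]_(alpha + N)) : divisor :=
  fun x => if x == Some 1 then None else Some (exc_div g x).

Definition Gamma alpha (chi : 'M[ratfun]_alpha) : Prop :=
  forall i j, den_mult (chi i j) (Some 0) = 0%N.

Definition Delta (xi : divisor) : Prop :=
  [/\ exists s : seq proj_line, forall x, x \notin s -> xi x = Some 0%N,
      xi (Some 1) = None
    & forall x, x != Some 1 -> xi x <> None].

(* The semigroup R_alpha.  "The denominator of det chi" is taken before
   cancellation: if the (local) Smith-McMillan form of chi is
   diag(e_1 / p_1, ..., e_alpha / p_alpha), then det chi is, up to a unit,
   (e_1 ... e_alpha) / (p_1 ... p_alpha), with denominator p_1 ... p_alpha.  The
   latter is the least common denominator of all the minors of chi (det chi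
   being one of them), which is how it is expressed below.  The denominator of
   det chi in lowest terms would be too small for alpha >= 2:
   diag(1 / (1 - c lambda), 1 - c lambda) has determinant 1, but every g with
   this characteristic function has 1 / c in its exceptional divisor.
   The condition [xi (Some 0) = Some 0] is not in the definition of Delta, but
   is needed since p_g(0) = det 1 = 1, so that the exceptional divisors do not
   contain the point 0. *)
Definition R_alpha alpha (chi : 'M[ratfun]_alpha) (xi : divisor) : Prop :=
  [/\ Gamma chi, Delta xi, xi (Some 0) = Some 0%N
    & forall k (rows cols : 'I_k -> 'I_alpha) (x : proj_line),
        leni (den_mult (\det (mxsub rows cols chi)) x) (xi x)].

End CharacteristicFunction.

(* Main.v *)
Require Import Defs.
From HB Require Import structures.
From mathcomp Require Import all_boot all_order all_algebra.
From mathcomp Require Import perm generic_quotient fraction boolp.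
From mathcomp Require Import classical_sets mpoly zify ring.
From Stdlib Require Eqdep_dec PeanoNat.

(** The points of the quotient are classified by the polynomial invariants a,
    b d^k c and the characteristic polynomial of d, in any characteristic.

    Every K-point phi of the quotient comes from a matrix: extend phi to a place
    of the field of rational functions on Mat(alpha + N) (Chevalley).  The vectors
    d^k c_j of the generic matrix span a finitely generated, hence free, module
    over the valuation ring of this place.  In a basis of this lattice the generic
    matrix becomes integral, and phi is the evaluation at its reduction.

    Two matrices with the same values of the invariants above give the same
    point: splitting off unreachable and unobservable eigenvectors by
    one-parameter degenerations leads to the sum of a minimal system and of a
    diagonal matrix, and minimal systems with the same b d^k c are conjugate.

    A pair (chi, Xi) in R_alpha is realized by induction on the degree of Xi.  With
    s = 1 / lambda, the lattice spanned over K[s] by K[s]^alpha and the columns of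
    chi contains some w / (s - s0) with w constant, unless chi is constant.
    Multiplying chi by the elementary factor with zero s - s0 in the direction w
    lowers the degree, and the inverse of this factor has a one-dimensional
    realization. *)

Set Implicit Arguments.
Unset Strict Implicit.
Unset Printing Implicit Defensive.

Import GRing.Theory.
Local Open Scope ring_scope.
Local Open Scope quotient_scope.

(* The notation of Defs, which mxalgebra shadows. *)
Local Notation genmx := Defs.genmx.
Local Notation "p %:F" := (@FracField.tofrac _ p).

(** * Extension of places *)

(** A point phi is given on invariants only, and a place extending it may be infinite at entries of
    the generic matrix. Conjugation over the fraction field does not change the invariants, so a
    conjugate with finite entries is enough. The lattice provides it because the invariants have
    finite values: the coefficients of the characteristic polynomial of d make the lattice finitely
    generated, by Cayley-Hamilton, and the values of b d^k c keep b finite on it.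

    Divisors are read in the coordinate s = 1 / lambda. There chi is a + b (s - d)^-1 c, the
    exceptional divisor is the spectrum of d, with s = 0 for lambda = infinity, and regularity at
    lambda = 0 is boundedness at s = infinity. Each embedding adds the eigenvalue 1 to d, so the
    limit forgets exactly the multiplicity of this eigenvalue; hence the infinite multiplicity at
    lambda = 1. *)

Section Places.
Variables (K : closedFieldType) (L : fieldType) (iota : {rmorphism K -> L}).
Implicit Types (G : L * K -> Prop) (P Q : {poly (L * K)}).

(* The graph of a K-algebra morphism to K defined on a subalgebra of L. *)
Definition place_graph G : Prop :=
  [/\ forall c, G (iota c, c), forall u v, G u -> G v -> G (u - v),
      forall u v, G u -> G v -> G (u * v) & forall y, G (0, y) -> y = 0].

Section Graph.
Variables (G : L * K -> Prop) (pG : place_graph G).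

Lemma place_const c : G (iota c, c). Proof. by case: pG. Qed.
Lemma placeB u v : G u -> G v -> G (u - v). Proof. by case: pG => _ + _ _; apply. Qed.
Lemma placeM u v : G u -> G v -> G (u * v). Proof. by case: pG => _ _ + _; apply. Qed.
Lemma place_fun x y y' : G (x, y) -> G (x, y') -> y = y'.
Proof.
move=> Gy Gy'; apply/eqP; rewrite -subr_eq0; apply/eqP.
have := placeB Gy Gy'.
have -> : (x, y) - (x, y') = (x - x, y - y') :> L * K by [].
by rewrite subrr; case: pG => _ _ _; apply.
Qed.
Lemma place0 : G 0. Proof. by have := place_const 0; rewrite rmorph0. Qed.
Lemma place1 : G 1. Proof. by have := place_const 1; rewrite rmorph1. Qed.
Lemma placeN u : G u -> G (- u).
Proof. by move=> Gu; rewrite -sub0r; apply: placeB Gu; apply: place0. Qed.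
Lemma placeD u v : G u -> G v -> G (u + v).
Proof. by move=> Gu Gv; rewrite -[v]opprK; apply/placeB/placeN. Qed.
Lemma place_sum I (r : seq I) (A : pred I) (F : I -> L * K) :
  (forall i, A i -> G (F i)) -> G (\sum_(i <- r | A i) F i).
Proof. by move=> GF; elim/big_ind: _ => //; [apply: place0 | apply: placeD]. Qed.
Lemma place_prod I (r : seq I) (A : pred I) (F : I -> L * K) :
  (forall i, A i -> G (F i)) -> G (\prod_(i <- r | A i) F i).
Proof. by move=> GF; elim/big_ind: _ => //; [apply: place1 | apply: placeM]. Qed.
Lemma placeX u n : G u -> G (u ^+ n).
Proof.
move=> Gu; elim: n => [|n IHn]; first exact: place1.
by rewrite exprS; apply: placeM.
Qed.

(** A polynomial over [L * K] is a pair of polynomials, so a relation over the domain of the place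
    is carried together with its residue. *)
Definition place_poly P := forall i, G P`_i.

Lemma place_polyB P Q : place_poly P -> place_poly Q -> place_poly (P - Q).
Proof. by move=> GP GQ i; rewrite coefB; apply: placeB. Qed.
Lemma place_polyM P Q : place_poly P -> place_poly Q -> place_poly (P * Q).
Proof. by move=> GP GQ i; rewrite coefM; apply: place_sum => j _; apply: placeM. Qed.
Lemma place_polyC u : G u -> place_poly u%:P.
Proof. by move=> Gu i; rewrite coefC; case: eqP => // _; apply: place0. Qed.
Lemma place_polyXn n : place_poly 'X^n.
Proof.
by move=> i; rewrite coefXn; case: eqP => _; [apply: place1 | apply: place0].
Qed.

Definition place_adjoin w : L * K -> Prop :=
  fun v => exists2 P, place_poly P & v = P.[w].

Lemma place_adjoin_graph w :
  (forall P, place_poly P -> (P.[w]).1 = 0 -> (P.[w]).2 = 0) ->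
  place_graph (place_adjoin w).
Proof.
move=> w0; split.
- by move=> c; exists (iota c, c)%:P; [apply/place_polyC/place_const | rewrite hornerC].
- move=> _ _ [P GP ->] [Q GQ ->]; exists (P - Q); first exact: place_polyB.
  by rewrite !hornerE.
- move=> _ _ [P GP ->] [Q GQ ->]; exists (P * Q); first exact: place_polyM.
  by rewrite hornerM.
- by move=> y [P GP Py]; have := w0 P GP; rewrite -Py; apply.
Qed.

Hypothesis maxG : forall G', place_graph G' -> (forall u, G u -> G' u) ->
  forall u, G' u -> G u.

Lemma max_place_mem w :
  (forall P, place_poly P -> (P.[w]).1 = 0 -> (P.[w]).2 = 0) -> G w.
Proof.
move=> w0; apply: (maxG (place_adjoin_graph w0)).
  by move=> u Gu; exists u%:P; [apply: place_polyC | rewrite hornerC].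
by exists 'X; rewrite ?hornerX //; exact: place_polyXn 1%N.
Qed.

(** The domain of a maximal place is local: a relation for [x^-1], multiplied by a power of x,
    becomes an element of G with first component 0. Its second component, a unit times the residue
    of the relation, is therefore 0. *)
Lemma max_placeV x y : G (x, y) -> y != 0 -> G (x^-1, y^-1).
Proof.
move=> Gxy yN0; have xN0 : x != 0.
  apply: contraNneq yN0 => x0; move: Gxy; rewrite x0.
  by case: pG => _ _ _ /[apply] ->.
apply: max_place_mem => P GP P0; set w := (_, _) in P0 *.
have vw : (x, y) * w = 1 by rewrite -[LHS]/(x * x^-1, y * y^-1) !divff.
have : G (P.[w] * (x, y) ^+ size P).
  rewrite horner_coef mulr_suml; apply: place_sum => i _.
  rewrite -[X in (x, y) ^+ X](subnKC (ltnW (ltn_ord i))) exprD.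
  rewrite -mulrA [w ^+ i * _]mulrA -exprMn [w * _]mulrC vw expr1n mul1r.
  by apply: placeM => //; apply: placeX.
have -> : P.[w] * (x, y) ^+ size P = (0, P.[w].2 * y ^+ size P).
  elim: (size P) => [|n]; first by rewrite !mulr1 -P0 -surjective_pairing.
  rewrite exprS mulrCA => ->.
  by rewrite -[LHS]/(x * 0, y * (_ * _)) mulr0 exprS mulrCA.
case: pG => _ _ _ /[apply] /eqP; rewrite mulf_eq0 expf_eq0 (negPf yN0) andbF orbF.
by move/eqP.
Qed.

(** The reciprocal polynomial X^n P(1/X) for a formal degree n. *)
Definition rev_at n P := \poly_(i < n.+1) P`_(n - i)%N.

Lemma place_poly_rev n P : place_poly P -> place_poly (rev_at n P).
Proof. by move=> GP i; rewrite coef_poly; case: ifP => // _; apply: place0. Qed.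

Lemma horner_rev n P (z : L) : (size P <= n.+1)%N -> z != 0 ->
  (map_poly fst (rev_at n P)).[z] = z ^+ n * (map_poly fst P).[z^-1].
Proof.
move=> sP zN0.
rewrite (@horner_coef_wide _ n.+1); last first.
  by rewrite (leq_trans (size_poly _ _)) // size_poly.
rewrite (@horner_coef_wide _ n.+1 (map_poly _ P)); last first.
  by rewrite (leq_trans (size_poly _ _)).
rewrite [RHS]mulr_sumr (reindex_inj rev_ord_inj) /=; apply: eq_bigr => i _.
rewrite !coef_map coef_poly /= subSS ltnS leq_subr subKn -1?ltnS //.
rewrite mulrCA; congr (_ * _); rewrite exprVn.
have ilen : (i <= n)%N by rewrite -ltnS.
by rewrite -[in X in _ = X / _](subnK ilen) exprD mulfK // expf_neq0.
Qed.

(** The constant term of Q, inverted by [u], is the leading coefficient of the reversed Q, so the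
    subtraction removes the coefficient of degree a. *)
Lemma size_rev_sub a b P Q u : (size P <= a.+1)%N -> (b <= a)%N -> u * Q`_0 = 1 ->
  (size (P - (P`_a * u)%:P * (rev_at b Q * 'X^(a - b)))%R <= a)%N.
Proof.
move=> /leq_sizeP sP ba uQ; apply/leq_sizeP => j aj.
rewrite coefB coefCM coefMXn coef_poly ltnNge (leq_trans (leq_subr _ _)) //=.
move: aj; rewrite leq_eqVlt => /predU1P [<-|aj].
  by rewrite subKn // ltnSn subnn -mulrA uQ mulr1 subrr.
by rewrite sP // ltnS leqNgt ltn_subRL subnK // aj mulr0 subrr.
Qed.

Lemma horner_rev_sub a b P Q u (z : L) : (size Q <= b.+1)%N -> z != 0 ->
  (map_poly fst Q).[z^-1] = 0 ->
  (map_poly fst (P - (P`_a * u)%:P * (rev_at b Q * 'X^(a - b)))).[z] =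
  (map_poly fst P).[z].
Proof.
move=> sQ zN0 Qz; rewrite rmorphB !rmorphM /= hornerD hornerN !hornerM horner_rev // Qz.
by rewrite mulr0 mul0r mulr0 subr0.
Qed.

Lemma place_rev_sub a b P Q u : place_poly P -> place_poly Q -> G u ->
  place_poly (P - (P`_a * u)%:P * (rev_at b Q * 'X^(a - b))).
Proof.
move=> GP GQ Gu; apply: place_polyB => //; apply: place_polyM.
  exact/place_polyC/placeM.
by apply: place_polyM; [apply: place_poly_rev | apply: place_polyXn].
Qed.

(* Such P and Q with Q_0 a unit could be shortened by cancelling the leading term
   of the longer one against the constant term of the other. *)
Lemma max_place_elim z p q P Q : z != 0 ->
  place_poly P -> place_poly Q -> (size P <= p.+1)%N -> (size Q <= q.+1)%N ->
  (map_poly fst P).[z] = 0 -> (map_poly fst Q).[z^-1] = 0 ->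
  map_poly snd P = 1 -> (Q`_0).2 = 0.
Proof.
move=> zN0; have [n] := ubnP (p + q); elim: n => // n IHn in p q P Q *.
rewrite ltnS => pqn GP GQ sP sQ Pz Qz P1.
have [//|Q0] := eqVneq (Q`_0).2 0.
have invG v : G v -> v.2 != 0 -> exists2 u, G u & u * v = 1.
  case: v => x y Gv /= y0; exists (x^-1, y^-1); first exact: max_placeV.
  have -> : (x^-1, y^-1) * (x, y) = (x^-1 * x, y^-1 * y) :> L * K by [].
  rewrite !mulVf //.
  apply: contraNneq y0 => x0; move: Gv; rewrite x0.
  by case: pG => _ _ _ /[apply] ->.
have P0 i : (P`_i).2 = (i == 0%N)%:R :> K by rewrite -(coef_map snd) P1 coef1.
have [qp|pq] := leqP q p.
(* For p = q = 0, Q is a constant with first component 0, and the graph forces its residue to be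
   0. *)
- case: p => [|p] in qp pqn sP *.
    case: q => // in qp pqn sQ *.
    move: Qz; rewrite (size1_polyC sQ) map_polyC hornerC /= => Q01.
    have := GQ 0%N; rewrite [Q`_0]surjective_pairing Q01 coefC.
    by case: pG => _ _ _; apply.
  have [u Gu uQ] := invG _ (GQ 0%N) Q0.
  (* The coefficient removed from P has positive degree, hence residue 0, so P' still reduces to
     1. *)
  pose P' := P - (P`_p.+1 * u)%:P * (rev_at q Q * 'X^(p.+1 - q)).
  apply: (IHn p q P' Q) => //.
  + exact: place_rev_sub.
  + exact: size_rev_sub.
  + by rewrite horner_rev_sub.
  + rewrite rmorphB !rmorphM /= map_polyC /= P1.
    by rewrite P0 !mul0r subr0.
- case: q => // q in pq pqn sQ *.
  have [|u Gu uP] := invG _ (GP 0%N); first by rewrite P0 oner_eq0.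
  (* Here the shift is positive, so the constant term of Q is not touched. *)
  pose Q' := Q - (Q`_q.+1 * u)%:P * (rev_at p P * 'X^(q.+1 - p)).
  have -> : (Q`_0).2 = (Q'`_0).2.
    by rewrite coefB coefCM coefMXn subn_gt0 pq mulr0 subr0.
  apply: (IHn p q P Q') => //.
  + by rewrite addnS in pqn.
  + exact: place_rev_sub.
  + by apply: size_rev_sub => //; rewrite ltnW.
  + by rewrite horner_rev_sub ?invrK ?invr_eq0.
Qed.

(** If z has no residue, the residues of the relations satisfied by z form an ideal I of K[X]
    without common root, since a common root could serve as a residue. As K is algebraically closed,
    I contains 1, and a relation for z with residue 1 forces the residue of every relation for
    [z^-1] to vanish at 0. *)
Lemma max_place_dichotomy z : (exists xi, G (z, xi)) \/ G (z^-1, 0).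
Proof.
have [|noG] := pselect (exists xi, G (z, xi)); [by left | right].
have zN0 : z != 0 by apply: contra_notN noG => /eqP ->; exists 0; apply: place0.
pose I h := exists P, [/\ place_poly P, (map_poly fst P).[z] = 0 & map_poly snd P = h].
have I0 xi : exists2 h, I h & h.[xi] != 0.
  apply: contra_notP noG => noh; exists xi; apply: max_place_mem => P GP Pz.
  apply/eqP; apply: contra_notT noh => Pxi; exists (map_poly snd P).
    by exists P; split=> //; rewrite -[z]/(z, xi).1 horner_map.
  by rewrite -[xi]/(z, xi).2 horner_map.
have IC h c : I h -> I (c *: h).
  move=> [P [GP Pz <-]]; exists ((iota c, c)%:P * P).
  split; first by apply/place_polyM => //; apply/place_polyC/place_const.
    by rewrite rmorphM hornerM Pz mulr0.
  by rewrite rmorphM /= map_polyC /= mul_polyC.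
have IB h h' t : I h -> I h' -> I (h - t * h').
  move=> [P [GP Pz <-]] [Q [GQ Qz <-]].
  pose T := map_poly (fun c => (iota c, c)) t.
  exists (P - T * Q); split.
  - apply/place_polyB/place_polyM => // i.
    by rewrite coef_poly; case: ifP => _; [apply: place_const | apply: place0].
  - by rewrite rmorphB rmorphM !hornerE Pz Qz mulr0 subr0.
  - rewrite rmorphB rmorphM; congr (_ - _ * _); apply/polyP => i.
    rewrite coef_map coef_poly; case: ltnP => // /leq_sizeP -> //.
(* Euclidean descent: at a root xi of h some t in I is nonzero, so t mod h is a nonzero element of I
   of smaller degree. *)
have I1 n h : h != 0 -> I h -> (size h <= n)%N -> I 1.
  elim: n h => [|n IHn] h hN0 Ih; first by rewrite leqn0 size_poly_eq0 (negPf hN0).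
  move=> sh; have [/eqP s1|] := boolP (size h == 1%N).
    have [c cN0 hc] := size_poly1P _ (introT eqP s1).
    have := IC h c^-1 Ih; rewrite hc -mul_polyC -polyCM mulVf //.
  move=> /closed_rootP [xi hxi]; have [t It txi] := I0 xi.
  apply: (IHn (t - t %/ h * h)); last 1 first.
  - rewrite {1}(divp_eq t h) addrC addKr -ltnS (leq_trans _ sh) // ltn_modp //.
  - apply: contraNneq txi => /eqP; rewrite subr_eq0 => /eqP ->.
    by rewrite hornerM (eqP hxi) mulr0.
  - exact: IB.
have {I1 I0 IC IB} [P [GP Pz P1]] : I 1.
  have [h Ih h0] := I0 0; apply: (I1 (size h) h) => //.
  by apply: contraNneq h0 => ->; rewrite horner0.
apply: max_place_mem => Q GQ.
rewrite -[(_.[_]).1](horner_map fst) -[(_.[_]).2](horner_map snd) /= => Qz.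
rewrite horner_coef0 coef_map /=.
by apply: (@max_place_elim z (size P) (size Q) P Q).
Qed.

End Graph.

Lemma place_extension G0 : place_graph G0 ->
  exists G, [/\ forall u, G0 u -> G u, place_graph G
    & forall z, (exists xi, G (z, xi)) \/ G (z^-1, 0)].
Proof.
(* Forming the union with [G0] makes the empty chain, whose union is empty, an admissible case of
   Zorn's lemma. *)
move=> pG0; pose Pr (A : set (L * K)) := place_graph (fun u => G0 u \/ A u).
have [F FPr Ftot|A [pA maxA]] := @Zorn_bigcup _ Pr.
  have two u v : G0 u \/ bigcup F id u -> G0 v \/ bigcup F id v ->
      exists G, [/\ place_graph G, G u, G v & forall w, G w -> G0 w \/ bigcup F id w].
    move=> [Gu|[A FA Au]] [Gv|[B FB Bv]].
    - by exists G0; split=> //; left.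
    - exists (fun u => G0 u \/ B u); split; [exact: FPr|by left|by right|].
      by move=> w [|Bw]; [left | right; exists B].
    - exists (fun u => G0 u \/ A u); split; [exact: FPr|by right|by left|].
      by move=> w [|Bw]; [left | right; exists A].
    - have [AB|BA] := Ftot A B FA FB.
        exists (fun u => G0 u \/ B u); split; [exact: FPr|by right; apply: AB|by right|].
        by move=> w [|Bw]; [left | right; exists B].
      exists (fun u => G0 u \/ A u); split; [exact: FPr|by right|by right; apply: BA|].
      by move=> w [|Bw]; [left | right; exists A].
  split.
  - by move=> c; left; case: pG0.
  - by move=> u v Gu Gv; have [G [pG {}Gu {}Gv]] := two u v Gu Gv; apply; apply: placeB.
  - by move=> u v Gu Gv; have [G [pG {}Gu {}Gv]] := two u v Gu Gv; apply; apply: placeM.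
  - by move=> y Gy; have [G [[_ _ _ G0y] {}Gy _ _]] := two _ _ Gy Gy; apply: G0y.
exists (fun u => G0 u \/ A u); split=> //; first by left.
apply: (@max_place_dichotomy (fun u => G0 u \/ A u)) => // G' pG' AG' u G'u.
right; apply: contrapT => Au.
have /maxA : (A `<` (G' : set _))%classic.
  by split=> [v Av|/(_ u G'u)//]; apply: AG'; right.
apply; rewrite /Pr (_ : (fun _ => _) = G') //.
apply/funext => v; apply/propext; split; last by right.
by case=> // G0v; apply: AG'; left.
Qed.

End Places.

(** * Integral models over a valuation ring *)

Lemma Cayley_Hamilton_sum (R : comNzRingType) n (A : 'M[R]_n) :
  \sum_(i < n.+1) (char_poly A)`_i *: A ^+ i = 0.
Proof.
case: n => [|n] in A *; first by rewrite [LHS]flatmx0 [RHS]flatmx0.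
rewrite -[RHS](Cayley_Hamilton A) /horner_mx /horner_morph.
rewrite (@horner_coef_wide _ n.+2); last first.
  by rewrite (leq_trans (size_poly _ _)) // size_char_poly.
by apply: eq_bigr => i _; rewrite coef_map /= -mul_scalar_mx.
Qed.

Lemma char_poly_lead (R : comNzRingType) n (A : 'M[R]_n) : (char_poly A)`_n = 1.
Proof. by have := monicP (char_poly_monic A); rewrite /lead_coef size_char_poly. Qed.

Lemma mxX_char_poly (R : comNzRingType) n (A : 'M[R]_n) k : (n <= k)%N ->
  A ^+ k = - \sum_(i < n) (char_poly A)`_i *: A ^+ (i + (k - n)).
Proof.
move=> nk; apply/eqP; rewrite -addr_eq0; apply/eqP.
have := congr1 (fun B => B * A ^+ (k - n)) (Cayley_Hamilton_sum A).
rewrite mul0r mulr_suml big_ord_recr /= char_poly_lead scale1r -exprD subnKC //.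
move=> A0; rewrite -[RHS]A0 addrC; congr (_ + _); apply: eq_bigr => i _.
by rewrite exprD -!mulmxE scalemxAl.
Qed.

Section IntegralModel.
Variables (L : fieldType) (O : L -> Prop).
Hypotheses (O1 : O 1) (OB : forall x y, O x -> O y -> O (x - y))
  (OM : forall x y, O x -> O y -> O (x * y)) (OV : forall x, O x \/ O x^-1).

Let O0 : O 0. Proof. by rewrite -(subrr 1); apply: OB. Qed.
Let ON x : O x -> O (- x). Proof. by rewrite -[- x]sub0r; apply: OB. Qed.
Let OD x y : O x -> O y -> O (x + y).
Proof. by move=> Ox Oy; rewrite -[y]opprK; apply/OB/ON. Qed.
Let O_sum I (r : seq I) (A : pred I) (F : I -> L) :
  (forall i, A i -> O (F i)) -> O (\sum_(i <- r | A i) F i).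
Proof. by move=> OF; elim/big_ind: _. Qed.

(** Divisibility in a valuation ring is total, so finitely many elements, not all zero, include one
    of least valuation. *)
Lemma exists_dividing_all (I : eqType) (D : I -> L) (s : seq I) i0 :
  D i0 != 0 -> exists i, D i != 0 /\ forall j, j \in i0 :: s -> O (D j / D i).
Proof.
move=> Di0; elim: s => [|j s [i [Di iP]]].
  by exists i0; split=> // j; rewrite inE => /eqP ->; rewrite divff.
have iP' k : k \in [:: i0, j & s] -> k = j \/ O (D k / D i).
  rewrite !inE => /or3P [/eqP ->|/eqP ->|ks]; [right|by left|right];
    by apply: iP; rewrite inE ?eqxx ?ks ?orbT.
have [Oji|] := OV (D j / D i).
  by exists i; split=> // k /iP' [->|].
rewrite invf_div => Oij; have [Dj0|Dj] := eqVneq (D j) 0.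
  by exists i; split=> // k /iP' [->|//]; rewrite Dj0 mul0r.
exists j; split=> // k /iP' [->|Oki]; first by rewrite divff.
have -> : D k / D j = (D k / D i) * (D i / D j) by rewrite mulrA divfK.
exact: OM.
Qed.

Lemma mulmx_adj_col n (A : 'M[L]_n) (v : 'cV_n) i :
  (\adj A *m v) i 0 = \det (\matrix_(r, j) if j == i then v r 0 else A r j).
Proof.
rewrite (expand_det_col _ i) mxE; apply: eq_bigr => r _.
rewrite !mxE eqxx mulrC; congr (_ * _); rewrite /cofactor; congr (_ * \det _).
by apply/matrixP => s j; rewrite !mxE eq_sym (negPf (neq_lift _ _)).
Qed.

Variables (N beta : nat) (d : 'M[L]_N) (C : 'M[L]_(N, beta)).

Let cols (f : {ffun 'I_N -> 'I_N * 'I_beta}) : 'M[L]_N :=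
  \matrix_(r, i) (d ^+ (f i).1 *m C) r (f i).2.

(* Columns d^k C_j (k < N) whose determinant divides all such determinants span
   a lattice containing all the others, by Cramer's rule. *)
Lemma integral_model (j0 : 'I_beta) :
  \det (\matrix_(r < N, i < N) (d ^+ i *m C) r j0) != 0 ->
  (forall i, O (char_poly d)`_i) ->
  exists (u : 'M[L]_N) (f : {ffun 'I_N -> 'I_N * 'I_beta}),
    [/\ u \in unitmx, forall r s, O ((u *m d *m invmx u) r s),
        forall r s, O ((u *m C) r s)
      & forall r i, invmx u r i = (d ^+ (f i).1 *m C) r (f i).2].
Proof.
move=> cyc Od; pose D f := \det (cols f).
have [|f [Df fP]] := @exists_dividing_all _ D (enum {ffun 'I_N -> 'I_N * 'I_beta})
    [ffun i => (i, j0)].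
  rewrite /D (_ : cols _ = \matrix_(r, i) (d ^+ i *m C) r j0) //.
  by apply/matrixP => r i; rewrite !mxE ffunE.
have {}fP g : O (D g / D f) by apply: fP; rewrite inE mem_enum orbT.
have uf : cols f \in unitmx by rewrite unitmxE unitfE.
exists (invmx (cols f)), f; rewrite unitmx_inv uf invmxK.
(* Every column of d^k C has integral coordinates in the chosen basis. For k < N they are quotients
   by [D f] of determinants in the list; for k >= N Cayley-Hamilton, with integral coefficients,
   lowers k. *)
have uE k r s : O ((invmx (cols f) *m (d ^+ k *m C)) r s).
  have [m] := ubnP k; elim: m => // m IHm in k r s *; rewrite ltnS => km.
  have [kN|Nk] := ltnP k N.
    have -> : (invmx (cols f) *m (d ^+ k *m C)) r s =
        D [ffun j => if j == r then (Ordinal kN, s) else f j] / D f.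
      rewrite /invmx uf -scalemxAl mxE mulrC; congr (_ / _).
      transitivity ((\adj (cols f) *m col s (d ^+ k *m C)) r 0).
        by rewrite !mxE; apply: eq_bigr => j _; rewrite !mxE.
      rewrite mulmx_adj_col /D; congr (\det _); apply/matrixP => i j.
      by rewrite !mxE ffunE; case: eqP => //= _; rewrite !mxE.
    exact: fP.
  rewrite (mxX_char_poly d Nk).
  rewrite mulNmx mulmxN mxE; apply: ON.
  rewrite mulmx_suml mulmx_sumr summxE; apply: O_sum => i _.
  rewrite -scalemxAl -scalemxAr mxE; apply/OM/IHm => //.
  by rewrite (leq_trans _ km) // -{2}(subnKC Nk) ltn_add2r.
split=> //.
- move=> r s; have := uE (f s).1.+1 r (f s).2.
  rewrite exprS -mulmxE -mulmxA [invmx _ *m _]mulmxA; congr O.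
  by rewrite !mxE; apply: eq_bigr => j _; rewrite [cols f _ _]mxE.
- by move=> r s; have := uE 0%N r s; rewrite expr0 mul1mx.
- by move=> r i; rewrite !mxE.
Qed.

End IntegralModel.

(** * Points of the quotient *)

Section ConjBlocks.
Variables (R : pzRingType) (alpha N : nat) (u v : 'M[R]_N) (g : 'M[R]_(alpha + N)).

Lemma coll_conjE : coll_conj u v g =
  block_mx (ulsubmx g) (ursubmx g *m v) (u *m dlsubmx g) (u *m drsubmx g *m v).
Proof.
rewrite /coll_conj -{1}[g]submxK !mulmx_block.
by rewrite !(mul1mx, mulmx1, mul0mx, mulmx0, addr0, add0r).
Qed.

End ConjBlocks.

Lemma char_poly_conj (R : comUnitRingType) n (u d : 'M[R]_n) :
  u \in unitmx -> char_poly (u *m d *m invmx u) = char_poly d.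
Proof.
move=> uU; pose C := map_mx (@polyC R).
rewrite /char_poly.
have -> : char_poly_mx (u *m d *m invmx u) = C _ _ u *m char_poly_mx d *m C _ _ (invmx u).
  rewrite /char_poly_mx mulmxBr mulmxBl !map_mxM; congr (_ - _).
  by rewrite scalar_mxC -mulmxA -map_mxM mulmxV // map_mx1 mulmx1.
rewrite !det_mulmx mulrAC -det_mulmx -map_mxM mulmxV //.
by rewrite map_mx1 det1 mul1r.
Qed.

(** Evaluation over a K-algebra: the field of fractions for the generic matrix, [{poly K}] for
    one-parameter families. *)
Definition mxval_ext (K : closedFieldType) (L : comNzRingType)
    (iota : {rmorphism K -> L}) n (g : 'M[L]_n) (f : mxpol K n) : L :=
  mmap iota (mxvec g 0) f.
HB.instance Definition _ K L iota n g :=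
  GRing.RMorphism.copy (@mxval_ext K L iota n g) (mmap iota (mxvec g 0)).

Lemma horner_mxval (K : closedFieldType) n (A : 'M[{poly K}]_n) f t :
  (mxval_ext (@polyC K) A f).[t] = mxval (map_mx (horner_eval t) A) f.
Proof.
rewrite -[LHS]/(horner_eval t _) /mxval mevalE raddf_sum /=; apply: eq_bigr => m _.
rewrite rmorphM /= /horner_eval hornerC; congr (_ * _).
rewrite /mmap1 horner_prod; apply: eq_bigr => i _.
by rewrite horner_exp -map_mxvec mxE.
Qed.

Section ExtensionOfScalars.
Variables (K : closedFieldType) (L : comNzRingType) (iota : {rmorphism K -> L}).

Lemma mxval_ext_subst m n (A : 'M[mxpol K n]_m) f (g : 'M[L]_n) :
  mxval_ext iota g (mxsubst A f) = mxval_ext iota (map_mx (mxval_ext iota g) A) f.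
Proof.
rewrite /mxval_ext /mxsubst raddf_sum /=; apply: eq_bigr => k _.
rewrite rmorphM /= mmapC; congr (_ * _); rewrite /mmap1 rmorph_prod /=.
by apply: eq_bigr => i _; rewrite rmorphXn -map_mxvec mxE.
Qed.

Lemma mxval_ext_genmx n (g : 'M[L]_n) : map_mx (mxval_ext iota g) (genmx K n) = g.
Proof. by apply/matrixP => i j; rewrite !mxE /mxval_ext mmapX mmap1U mxvecE. Qed.

Variables alpha N : nat.
Local Notation U u := (block_mx (1%:M : 'M_alpha) 0 0 u).

(* Invariance stated without inverses: as a polynomial identity in u and h, it
   holds over every commutative K-algebra. *)
Lemma coll_inv_comm (f : mxpol K (alpha + N)) (u : 'M[K]_N) (h : 'M[K]_(alpha + N)) :
  f \in @coll_inv K alpha N -> mxval (U u *m h) f = mxval (h *m U u) f.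
Proof.
move=> /coll_invP fP.
have unitE v : v \in unitmx -> mxval (U v *m h) f = mxval (h *m U v) f.
  move=> vU; rewrite -(fP _ (h *m U v) vU) /coll_conj -!mulmxA; congr mxval.
  congr (_ *m _); rewrite mulmx_block.
  rewrite !(mul1mx, mulmx1, mul0mx, mulmx0, addr0, add0r) mulmxV //.
  by rewrite -scalar_mx_block mulmx1.
(* The shift of u by X has nonzero determinant, a characteristic polynomial. The identity, known
   where u + t is invertible, thus holds in K[X] and is read off at X = 0. *)
pose u' : 'M[{poly K}]_N := map_mx polyC u + 'X%:M.
have u'E t : map_mx (horner_eval t) u' = u + t%:M.
  rewrite map_mxD -map_mx_comp map_scalar_mx /= /horner_eval hornerX; congr (_ + _).
  by apply/matrixP => i j; rewrite !mxE /= /horner_eval hornerC.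
pose P (A : 'M[{poly K}]_(alpha + N)) := mxval_ext (@polyC K) A f.
have PE A t : (P A).[t] = mxval (map_mx (horner_eval t) A) f by apply: horner_mxval.
pose h' : 'M[{poly K}]_(alpha + N) := map_mx polyC h.
have h'E t : map_mx (horner_eval t) h' = h.
  by apply/matrixP => i j; rewrite !mxE /horner_eval hornerC.
have : (P (U u' *m h') - P (h' *m U u')) * \det u' = 0.
  apply: poly_eq0_horner => t; rewrite !hornerE !PE !map_mxM h'E.
  rewrite !map_block_mx !map_mx0 !map_mx1 u'E.
  rewrite -[(\det _).[t]]/(horner_eval t _) -det_map_mx u'E.
  have [uU|] := boolP (u + t%:M \in unitmx); first by rewrite unitE // subrr mul0r.
  by rewrite unitmxE unitfE negbK => /eqP ->; rewrite mulr0.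
move/eqP; rewrite mulf_eq0 => /orP [/eqP P0|]; last first.
  have -> : u' = char_poly_mx (- u) by rewrite /char_poly_mx map_mxN opprK addrC.
  by rewrite (negPf (monic_neq0 (char_poly_monic _))).
have := congr1 (fun p => p.[0]) P0; rewrite !hornerE !PE !map_mxM h'E.
rewrite !map_block_mx !map_mx0 !map_mx1 u'E raddf0 addr0 => /eqP.
by rewrite subr_eq0 => /eqP.
Qed.

Lemma coll_inv_ext (f : mxpol K (alpha + N)) (u v : 'M[L]_N) (g : 'M[L]_(alpha + N)) :
  f \in @coll_inv K alpha N -> v *m u = 1%:M ->
  mxval_ext iota (coll_conj u v g) f = mxval_ext iota g f.
Proof.
move=> fP vu.
(* One generic matrix supplies independent h and u as its diagonal blocks, so [coll_inv_comm]
   becomes an identity of polynomials that can be specialized to L. *)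
pose X := genmx K ((alpha + N) + N).
have E : mxsubst (U (drsubmx X) *m ulsubmx X) f = mxsubst (ulsubmx X *m U (drsubmx X)) f.
  apply: mxval_inj => z.
  rewrite [LHS]mxval_subst [RHS]mxval_subst.
  rewrite (map_mxM (mxval z)) (map_mxM (mxval z)) !(map_block_mx (mxval z)).
  rewrite (map_mx0 (mxval z)) (map_mx0 (mxval z)) (map_mx1 (mxval z)).
  apply: coll_inv_comm fP.
pose z := block_mx (g *m U v) 0 0 u.
have := congr1 (mxval_ext iota z) E.
rewrite [LHS]mxval_ext_subst [RHS]mxval_ext_subst.
rewrite (map_mxM (mxval_ext iota z)) (map_mxM (mxval_ext iota z)).
rewrite !(map_block_mx (mxval_ext iota z)).
rewrite (map_mx0 (mxval_ext iota z)) (map_mx0 (mxval_ext iota z)).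
rewrite (map_mx1 (mxval_ext iota z)).
rewrite map_drsubmx map_ulsubmx mxval_ext_genmx block_mxKul block_mxKdr.
rewrite /coll_conj mulmxA => ->; congr mxval_ext; rewrite -mulmxA mulmx_block.
by rewrite !(mul1mx, mulmx1, mul0mx, mulmx0, addr0, add0r) vu -scalar_mx_block mulmx1.
Qed.

End ExtensionOfScalars.

(** * Markov parameters and a cyclic test matrix *)

Section Moments.
Variable alpha : nat.

(** The Markov parameters: [moment g k] is the coefficient of lambda^(k+1) in the characteristic
    function. *)
Definition moment (R : pzRingType) N (g : 'M[R]_(alpha + N)) k : 'M[R]_alpha :=
  ursubmx g *m drsubmx g ^+ k *m dlsubmx g.

Lemma map_mxX (R S : pzRingType) (f : {rmorphism R -> S}) n (A : 'M[R]_n) k :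
  map_mx f (A ^+ k) = map_mx f A ^+ k.
Proof.
elim: k => [|k IHk]; first by rewrite !expr0 map_mx1.
by rewrite !exprS map_mxM IHk.
Qed.

Lemma map_moment (R S : pzRingType) (f : {rmorphism R -> S}) N
    (g : 'M[R]_(alpha + N)) k :
  map_mx f (moment g k) = moment (map_mx f g) k.
Proof. by rewrite /moment !map_mxM map_mxX map_ursubmx map_drsubmx map_dlsubmx. Qed.

Lemma conj_mxX (R : pzRingType) n (u v d : 'M[R]_n) k :
  v *m u = 1%:M -> u *m v = 1%:M -> (u *m d *m v) ^+ k = u *m d ^+ k *m v.
Proof.
move=> vu uv; elim: k => [|k IHk]; first by rewrite !expr0 mulmx1 uv.
by rewrite !exprS IHk -!mulmxE !mulmxA -[_ *m v *m u]mulmxA vu mulmx1.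
Qed.

Lemma moment_conj (R : pzRingType) N (u v : 'M[R]_N) (g : 'M[R]_(alpha + N)) k :
  v *m u = 1%:M -> u *m v = 1%:M -> moment (coll_conj u v g) k = moment g k.
Proof.
move=> vu uv; rewrite coll_conjE /moment block_mxKur block_mxKdl block_mxKdr.
rewrite conj_mxX // !mulmxA -[ursubmx g *m v *m u]mulmxA vu mulmx1.
by rewrite -[_ *m v *m u]mulmxA vu mulmx1.
Qed.

End Moments.

Section ShiftMatrix.
Variables (R : pzRingType) (N : nat).

(** The nilpotent Jordan block, with cyclic vector e_0: a test point at which the cyclicity
    determinant is 1. *)
Definition shiftmx : 'M[R]_N := \matrix_(r, s) (r == s.+1 :> nat)%:R.

Lemma shiftmxX_col i r : (i < N)%N ->
  (shiftmx ^+ i *m \col_s (s == 0 :> nat)%:R) r 0 = (r == i :> nat)%:R.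
Proof.
elim: i r => [|i IHi] r iN; first by rewrite expr0 mul1mx mxE.
rewrite exprS -mulmxE -mulmxA mxE (bigD1 (Ordinal (ltnW iN))) //=.
rewrite IHi ?(ltnW iN) // mxE /= eqxx mulr1 big1 ?addr0 // => s /eqP si.
rewrite IHi ?(ltnW iN) //; case: eqP => [si'|]; last by rewrite mulr0.
by case: si; apply: val_inj.
Qed.

End ShiftMatrix.

Section PointsOfTheQuotient.
Variables (K : closedFieldType) (alpha N : nat).
Local Notation S := (mxpol K (alpha + N)).
Local Notation L := {fraction S}.
Let iota : {rmorphism K -> L} := @FracField.tofrac S \o @mpolyC _ K.
Let g0 : 'M[L]_(alpha + N) := map_mx (@FracField.tofrac S) (genmx K (alpha + N)).

Lemma mxval_ext_generic (f : S) : mxval_ext iota g0 f = FracField.tofrac f.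
Proof.
rewrite {2}(mpolyE f) rmorph_sum; apply: eq_bigr => m _.
rewrite -mul_mpolyC rmorphM; congr (_ * _).
rewrite (mpolyXE _ 1%g) rmorph_prod; apply: eq_bigr => i _; rewrite perm1 rmorphXn.
by case/mxvec_indexP: i => i j; rewrite mxvecE !mxE.
Qed.

Lemma coll_inv_entry i j :
  genmx K (alpha + N) (lshift N i) (lshift N j) \in @coll_inv K alpha N.
Proof.
have E g : mxval g (genmx K (alpha + N) (lshift N i) (lshift N j)) = ulsubmx g i j.
  by rewrite -[in RHS](mxval_genmx g) !mxE.
by apply/coll_invP => u g _; rewrite !E coll_conjE block_mxKul.
Qed.

Lemma coll_inv_moment k i j : moment (genmx K (alpha + N)) k i j \in @coll_inv K alpha N.
Proof.
have E g : mxval g (moment (genmx K (alpha + N)) k i j) = moment g k i j.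
  by rewrite -[in RHS](mxval_genmx g) -map_moment [RHS]mxE.
by apply/coll_invP => u g uU; rewrite !E moment_conj ?mulmxV ?mulVmx.
Qed.

Lemma coll_inv_char k :
  (char_poly (drsubmx (genmx K (alpha + N))))`_k \in @coll_inv K alpha N.
Proof.
have E g : mxval g (char_poly (drsubmx (genmx K (alpha + N))))`_k =
    (char_poly (drsubmx g))`_k.
  by rewrite -[in RHS](mxval_genmx g) -map_drsubmx -map_char_poly coef_map.
by apply/coll_invP => u g uU; rewrite !E coll_conjE block_mxKdr char_poly_conj.
Qed.

Section Point.
Variable phi : coll_quot K alpha N.

Let G0 (z : L * K) :=
  exists f : inv_alg K alpha N, z = (FracField.tofrac (inv_val f), phi f).

Lemma quot_place_graph : place_graph iota G0.
Proof.
split.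
- move=> c; exists (c%:A); rewrite linearZ /= rmorph1; congr pair; last first.
    by rewrite /GRing.scale /= mulr1.
  by rewrite -mul_mpolyC mulr1.
- by move=> _ _ [f ->] [f' ->]; exists (f - f'); rewrite !rmorphB.
- by move=> _ _ [f ->] [f' ->]; exists (f * f'); rewrite !rmorphM.
- move=> y [f [/esym/eqP]]; rewrite tofrac_eq0 => /eqP f0 ->.
  by have -> : f = 0; [apply: val_inj | rewrite rmorph0].
Qed.

Lemma place_mxval G (g : 'M[L]_(alpha + N)) (r : 'M[K]_(alpha + N)) (f : S) :
  place_graph iota G -> (forall i j, G (g i j, r i j)) ->
  G (mxval_ext iota g f, mxval r f).
Proof.
move=> pG gr.
pose v i : L * K := (mxvec g 0 i, mxvec r 0 i).
have Gv i : G (v i) by case/mxvec_indexP: i => i j; rewrite /v !mxvecE.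
pose V := \sum_(m <- msupp f) (iota f@_m, f@_m) * \prod_i v i ^+ m i.
have -> : (mxval_ext iota g f, mxval r f) = V.
  rewrite [V]surjective_pairing; congr pair.
    rewrite /V (rmorph_sum (@fst L K)); apply: eq_bigr => m _.
    rewrite (rmorphM (@fst L K)) (rmorph_prod (@fst L K)).
    by congr (_ * _); apply: eq_bigr => i _; rewrite (rmorphXn (@fst L K)).
  rewrite /V (rmorph_sum (@snd L K)) /mxval mevalE; apply: eq_bigr => m _.
  rewrite (rmorphM (@snd L K)) (rmorph_prod (@snd L K)).
  by congr (_ * _); apply: eq_bigr => i _; rewrite (rmorphXn (@snd L K)).
apply: (place_sum pG) => m _; apply: (placeM pG); first exact: (place_const pG).
by apply: (place_prod pG) => i _; apply: (placeX pG).
Qed.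

(** C is the block c, or an auxiliary cyclic vector when alpha = 0 and c has no columns. In the
    lattice basis b becomes integral, its values on the basis vectors d^k C_j being invariants; the
    last hypothesis gets the integrality of c from that of C. *)
Lemma quot_point_cyclic beta (C : 'M[L]_(N, beta)) (j0 : 'I_beta) :
  let d := drsubmx g0 in
  \det (\matrix_(r < N, i < N) (d ^+ i *m C) r j0) != 0 ->
  (forall k i j, exists f, f \in @coll_inv K alpha N /\
      (ursubmx g0 *m d ^+ k *m C) i j = FracField.tofrac f) ->
  (forall G, place_graph iota G -> forall u : 'M_N,
      (forall i j, exists xi, G ((u *m C) i j, xi)) ->
      forall i j, exists xi, G ((u *m dlsubmx g0) i j, xi)) ->
  exists g, phi = coll_point g.
Proof.
move=> d cyc bC uC.
have [G [GG pG dich]] := place_extension quot_place_graph.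
pose O x := exists xi, G (x, xi).
have Oinv f : f \in @coll_inv K alpha N -> O (FracField.tofrac f).
  by move=> fP; exists (phi (InvAlg fP)); apply: GG; exists (InvAlg fP).
have [|||||u [f [uU Od Oc uV]]] := @integral_model _ O _ _ _ _ _ _ d C j0 cyc.
- by exists 1; apply: (place1 pG).
- by move=> x y [xi Gx] [eta Gy]; exists (xi - eta); apply: (placeB pG Gx Gy).
- by move=> x y [xi Gx] [eta Gy]; exists (xi * eta); apply: (placeM pG Gx Gy).
- by move=> x; have [|Gx] := dich x; [left | right; exists 0].
- move=> i; rewrite /d /g0 -map_drsubmx -map_char_poly coef_map.
  exact/Oinv/coll_inv_char.
have Og' i j : O (coll_conj u (invmx u) g0 i j).
  rewrite coll_conjE; case: (split_ordP i) => {}i ->; case: (split_ordP j) => {}j ->;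
    rewrite ?(block_mxEul, block_mxEur, block_mxEdl, block_mxEdr).
  - have -> : ulsubmx g0 i j = FracField.tofrac (genmx K _ (lshift N i) (lshift N j)).
      by rewrite mxE mxE [LHS]mxE.
    exact/Oinv/coll_inv_entry.
  - have [t [tP tE]] := bC (f j).1 i (f j).2; have := Oinv t tP; rewrite -tE.
    congr O; rewrite -mulmxA mxE [RHS]mxE; apply: eq_bigr => s _.
    by rewrite uV.
  - exact: uC.
  - exact: Od.
have [r Gr] := choice (fun ij => Og' ij.1 ij.2).
exists (\matrix_(i, j) r (i, j)); apply: coll_quot_eq => t.
(* Both values are the residue of the fraction t: one by the graph of phi, the other because t is
   invariant under conjugation by u over L. *)
apply: (place_fun pG (x := FracField.tofrac (inv_val t))).
  by apply: GG; exists t.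
rewrite -mxval_ext_generic -(@coll_inv_ext _ _ _ _ _ _ u (invmx u)); last 2 first.
- exact: valP.
- exact: mulVmx.
by apply: place_mxval => // i j; rewrite mxE; apply: (Gr (i, j)).
Qed.

End Point.

(** The determinant is a polynomial whose value at a shift matrix with starting vector e_0 is 1. *)
Lemma generic_cyclic beta (C : 'M[S]_(N, beta)) (j0 : 'I_beta) (c : 'M[K]_(N, alpha)) :
  (forall r, mxval (block_mx 0 0 c (shiftmx K N)) (C r j0) = (r == 0 :> nat)%:R) ->
  \det (\matrix_(r < N, i < N)
    (drsubmx g0 ^+ i *m map_mx (@FracField.tofrac S) C) r j0) != 0.
Proof.
move=> Cc; set g : 'M[K]_(alpha + N) := block_mx 0 0 c _ in Cc.
pose X := drsubmx (genmx K (alpha + N)).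
rewrite (_ : \matrix_(r, i) _ =
  map_mx (@FracField.tofrac S) (\matrix_(r < N, i < N) (X ^+ i *m C) r j0)); last first.
  apply/matrixP => r i; rewrite [LHS]mxE /g0 -map_drsubmx -map_mxX -map_mxM.
  by rewrite [LHS]mxE [RHS]mxE; congr FracField.tofrac; rewrite [RHS]mxE.
rewrite det_map_mx tofrac_eq0; apply/eqP => /(congr1 (mxval g)).
rewrite rmorph0 -det_map_mx (_ : map_mx _ _ = 1%:M); last first.
  apply/matrixP => r i; rewrite [LHS]mxE [in LHS]mxE.
  transitivity (map_mx (mxval g) (X ^+ i *m C) r j0); first by rewrite [RHS]mxE.
  rewrite map_mxM map_mxX map_drsubmx mxval_genmx block_mxKdr [RHS]mxE.
  rewrite -[RHS](shiftmxX_col K r (ltn_ord i)) mxE [RHS]mxE; apply: eq_bigr => s _.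
  by congr (_ * _); rewrite [LHS]mxE [LHS]Cc mxE.
by rewrite det1 => /eqP; rewrite oner_eq0.
Qed.

Lemma coll_quot_point (phi : coll_quot K alpha N) : exists g, phi = coll_point g.
Proof.
(* For alpha = 0 the constant vector e_0 replaces the missing columns of c, and the conditions on b
   and c are vacuous. *)
have [alpha0|/card_gt0P [j0 _]] := posnP #|'I_alpha|.
  have noI (i : 'I_alpha) : False.
    by move: (ltn_ord i); rewrite -{2}(card_ord alpha) alpha0.
  pose C : 'M[S]_(N, 1) := \col_r (r == 0 :> nat)%:R.
  apply: (@quot_point_cyclic phi _ (map_mx (@FracField.tofrac S) C) 0).
  - apply: (@generic_cyclic _ _ _ 0) => r; rewrite mxE.
    by rewrite rmorph_nat.
  - by move=> k i; case: (noI i).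
  - by move=> G _ u _ i j; case: (noI j).
apply: (@quot_point_cyclic phi _ (dlsubmx g0) j0) => //.
- have -> : dlsubmx g0 = map_mx (@FracField.tofrac S) (dlsubmx (genmx K _)).
    by rewrite map_dlsubmx.
  apply: (@generic_cyclic _ _ _ (\matrix_(r, _) (r == 0 :> nat)%:R)) => r.
  transitivity (map_mx (mxval (block_mx 0 0 (\matrix_(r, _) (r == 0 :> nat)%:R)
    (shiftmx K N))) (dlsubmx (genmx K (alpha + N))) r j0); first by rewrite [RHS]mxE.
  by rewrite map_dlsubmx mxval_genmx block_mxKdl mxE.
- move=> k i j; exists (moment (genmx K (alpha + N)) k i j).
  split; first exact: coll_inv_moment.
  by rewrite -[LHS]/(moment g0 k i j) /g0 -map_moment mxE.
Qed.

End PointsOfTheQuotient.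

(** * Separation of points *)

Section PointEquality.
Variables (K : closedFieldType) (alpha : nat).

Lemma eq_coll_point N (g h : 'M[K]_(alpha + N)) :
  (forall f, f \in @coll_inv K alpha N -> mxval g f = mxval h f) ->
  coll_point g = coll_point h.
Proof. by move=> gh; apply: coll_quot_eq => f; apply/gh/valP. Qed.

Lemma coll_point_mxval N (g h : 'M[K]_(alpha + N)) f :
  coll_point g = coll_point h -> f \in @coll_inv K alpha N -> mxval g f = mxval h f.
Proof.
by move=> gh fP; have := congr1 (fun phi : coll_quot K alpha N => phi (InvAlg fP)) gh.
Qed.

Lemma coll_point_conj N (u : 'M[K]_N) (g : 'M[K]_(alpha + N)) :
  u \in unitmx -> coll_point (coll_conj u (invmx u) g) = coll_point g.
Proof. by move=> uU; apply: eq_coll_point => f /coll_invP; apply. Qed.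

Section Invariants.
Variables (N : nat) (g h : 'M[K]_(alpha + N)).
Hypothesis gh : coll_point g = coll_point h.

Lemma coll_point_ulsubmx : ulsubmx g = ulsubmx h.
Proof.
apply/matrixP => i j; have := coll_point_mxval gh (coll_inv_entry K N i j).
by rewrite -{2}(mxval_genmx g) -{2}(mxval_genmx h) !mxE.
Qed.

Lemma coll_point_moment k : moment g k = moment h k.
Proof.
apply/matrixP => i j; have := coll_point_mxval gh (coll_inv_moment K N k i j).
rewrite -{2}(mxval_genmx g) -{2}(mxval_genmx h) -!map_moment.
by rewrite [X in _ -> X = _]mxE [X in _ -> _ = X]mxE.
Qed.

Lemma coll_point_char_poly : char_poly (drsubmx g) = char_poly (drsubmx h).
Proof.
apply/polyP => k; have := coll_point_mxval gh (coll_inv_char K alpha N k).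
rewrite -{2}(mxval_genmx g) -{2}(mxval_genmx h) -!map_drsubmx -!map_char_poly.
by rewrite !coef_map.
Qed.

End Invariants.

(** Invariants do not separate an orbit from its closure: a polynomial in t that is constant for t
    != 0 is constant. The factor ['X] in the proof discards t = 0. *)
Lemma coll_point_limit N (A : 'M[{poly K}]_(alpha + N)) (g : 'M[K]_(alpha + N)) :
  (forall t, t != 0 -> coll_point (map_mx (horner_eval t) A) = coll_point g) ->
  coll_point (map_mx (horner_eval 0) A) = coll_point g.
Proof.
move=> Ag; apply: eq_coll_point => f fP.
have : (mxval_ext (@polyC K) A f - (mxval g f)%:P) * 'X = 0.
  apply: poly_eq0_horner => t; rewrite !hornerE horner_mxval.
  have [->|t0] := eqVneq t 0; first by rewrite mulr0.
  by rewrite (coll_point_mxval (Ag t t0) fP) subrr mul0r.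
move/eqP; rewrite mulf_eq0 polyX_eq0 orbF subr_eq0 => /eqP E.
by rewrite -horner_mxval E hornerC.
Qed.

(** Transposition carries orbits to orbits, u acting through its inverse transpose; this reduces
    unobservable systems to unreachable ones. *)
Lemma coll_point_tr N (g h : 'M[K]_(alpha + N)) :
  coll_point g = coll_point h -> coll_point g^T = coll_point h^T.
Proof.
move=> gh; apply: eq_coll_point => f /coll_invP fP.
pose f' := mxsubst (genmx K (alpha + N))^T f.
have f'E z : mxval z f' = mxval z^T f.
  by rewrite mxval_subst; congr mxval; rewrite -map_trmx mxval_genmx.
rewrite -!f'E; apply: coll_point_mxval gh _; apply/coll_invP => u z uU.
have uTU : invmx u^T \in unitmx by rewrite unitmx_inv unitmx_tr.
rewrite !f'E -(fP _ z^T uTU); congr mxval; rewrite /coll_conj !trmx_mul.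
by rewrite !tr_block_mx !trmx0 !trmx1 !trmx_inv invmxK mulmxA.
Qed.

End PointEquality.

(** * Reachability, observability and minimal systems *)

Section Minimality.
Variables (K : fieldType) (alpha : nat).

(** Controllability of (d, c), in dual form; for the transposed matrix it is observability of (b,
    d). *)
Definition reachable N (g : 'M[K]_(alpha + N)) := forall y : 'rV_N,
  (forall k, y *m drsubmx g ^+ k *m dlsubmx g = 0) -> y = 0.

Definition minimal N (g : 'M[K]_(alpha + N)) := reachable g /\ reachable g^T.

(** The Kalman matrix with L blocks; L is free so that systems of different sizes give Hankel
    matrices of the same shape. *)
Definition reach_mx L N (g : 'M[K]_(alpha + N)) : 'M_(N, \sum_(k < L) alpha) :=
  \mxrow_(k < L) (drsubmx g ^+ k *m dlsubmx g).

Definition obs_mx L N (g : 'M[K]_(alpha + N)) : 'M_(\sum_(k < L) alpha, N) :=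
  \mxcol_(k < L) (ursubmx g *m drsubmx g ^+ k).

Lemma reach_mx_free L N (g : 'M[K]_(alpha + N)) :
  reachable g -> (N <= L)%N -> row_free (reach_mx L g).
Proof.
move=> rg NL; apply: inj_row_free => y; rewrite /reach_mx mul_mxrow => y0.
have {}y0 k : (k < L)%N -> y *m drsubmx g ^+ k *m dlsubmx g = 0.
  move=> kL; move: y0; rewrite -mxrow0 => /eq_mxrowP /(_ (Ordinal kL)) /= <-.
  by rewrite mulmxA.
apply: rg => k; have [m] := ubnP k; elim: m => // m IHm in k *; rewrite ltnS => km.
have [Nk|kN] := leqP N k; last by rewrite y0 // (leq_trans kN).
rewrite (mxX_char_poly _ Nk) mulmxN mulNmx mulmx_sumr mulmx_suml big1 ?oppr0 // => i _.
rewrite -scalemxAr -scalemxAl IHm ?scaler0 //.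
by rewrite (leq_trans _ km) // -{2}(subnKC Nk) ltn_add2r.
Qed.

Lemma tr_mxX (R : comPzRingType) n (d : 'M[R]_n) k : (d ^+ k)^T = d^T ^+ k.
Proof.
elim: k => [|k IHk]; first by rewrite !expr0 trmx1.
by rewrite exprS exprSr -!mulmxE trmx_mul IHk.
Qed.

Lemma obs_mxE L N (g : 'M[K]_(alpha + N)) : obs_mx L g = (reach_mx L g^T)^T.
Proof.
rewrite /obs_mx /reach_mx tr_mxrow; apply: eq_mxcol => k.
by rewrite trmx_mul tr_mxX -trmx_drsub -trmx_ursub !trmxK.
Qed.

Lemma obs_mx_full L N (g : 'M[K]_(alpha + N)) :
  reachable g^T -> (N <= L)%N -> row_full (obs_mx L g).
Proof.
move=> rg NL; rewrite obs_mxE /row_full mxrank_tr.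
exact: reach_mx_free.
Qed.

(** The product is a shifted block Hankel matrix. As it sees only the moments, equal moments make
    the Kalman matrices of two systems comparable. *)
Lemma obs_reach_mx L N (g : 'M[K]_(alpha + N)) k :
  obs_mx L g *m drsubmx g ^+ k *m reach_mx L g =
  \mxblock_(i < L, j < L) moment g (i + k + j).
Proof.
rewrite /obs_mx /reach_mx mxcol_mul mul_mxcol_mxrow; apply: eq_mxblock => i j.
by rewrite /moment !exprD -!mulmxE !mulmxA.
Qed.

Lemma obs_reach_mx_eq L N M (g : 'M[K]_(alpha + N)) (h : 'M[K]_(alpha + M)) k :
  (forall k, moment g k = moment h k) ->
  obs_mx L g *m drsubmx g ^+ k *m reach_mx L g =
  obs_mx L h *m drsubmx h ^+ k *m reach_mx L h.
Proof. by move=> gh; rewrite !obs_reach_mx; apply: eq_mxblock => i j. Qed.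

(** Both sizes are the rank of the common Hankel matrix. *)
Lemma minimal_size N M (g : 'M[K]_(alpha + N)) (h : 'M[K]_(alpha + M)) :
  minimal g -> minimal h -> (forall k, moment g k = moment h k) -> N = M.
Proof.
move=> [rg og] [rh oh] /(obs_reach_mx_eq (N + M) 0).
rewrite !expr0 !mulmx1 => /(congr1 mxrank).
rewrite !mxrankMfree ?reach_mx_free ?leq_addl ?leq_addr //.
have /eqP -> := obs_mx_full og (leq_addr M N).
by have /eqP -> := obs_mx_full oh (leq_addl N M).
Qed.

(* The state space isomorphism theorem of linear system theory. *)
Lemma minimal_conj N (g h : 'M[K]_(alpha + N)) : minimal g -> minimal h ->
  ulsubmx g = ulsubmx h -> (forall k, moment g k = moment h k) ->
  exists2 u, u \in unitmx & h = coll_conj u (invmx u) g.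
Proof.
move=> [rg og] [rh oh] a_eq m_eq.
have OdR k := obs_reach_mx_eq N k m_eq.
have OR := OdR 0%N; rewrite !expr0 !mulmx1 in OR.
have /row_fullP [Bg Bg1] := obs_mx_full og (leqnn N).
have /row_fullP [Bh Bh1] := obs_mx_full oh (leqnn N).
have /row_freeP [Ch Ch1] := reach_mx_free rh (leqnn N).
(* [u] matches states with the same observations; the common Hankel matrix shows that it carries the
   reachability matrix of g to that of h. *)
pose u := Bh *m obs_mx N g; pose v := Bg *m obs_mx N h.
have uR : u *m reach_mx N g = reach_mx N h by rewrite -mulmxA OR mulmxA Bh1 mul1mx.
have vR : v *m reach_mx N h = reach_mx N g by rewrite -mulmxA -OR mulmxA Bg1 mul1mx.
have cancelR m (A B : 'M_(m, N)) : A *m reach_mx N h = B *m reach_mx N h -> A = B.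
  by move=> /(congr1 (mulmx^~ Ch)); rewrite -!mulmxA Ch1 !mulmx1.
have uv : u *m v = 1%:M by apply: cancelR; rewrite -mulmxA vR uR mul1mx.
have [uU _] := mulmx1_unit uv; exists u => //.
have -> : invmx u = v by rewrite -[v]mul1mx -(mulVmx uU) -mulmxA uv mulmx1.
have dE : u *m drsubmx g *m v = drsubmx h.
  apply: cancelR; rewrite -mulmxA vR -[u]/(_ *m _) -!mulmxA.
  by have := OdR 1%N; rewrite !expr1 -!mulmxA => ->; rewrite mulmxA Bh1 mul1mx.
have cE : u *m dlsubmx g = dlsubmx h.
  rewrite -[LHS]mulmxA (_ : _ *m dlsubmx g = obs_mx N h *m dlsubmx h).
    by rewrite mulmxA Bh1 mul1mx.
  rewrite /obs_mx !mxcol_mul; apply: eq_mxcol => k; exact: m_eq.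
have bE : ursubmx g *m v = ursubmx h.
  apply: cancelR; rewrite -mulmxA vR /reach_mx !mul_mxrow; apply: eq_mxrow => k.
  by rewrite !mulmxA; apply: m_eq.
by rewrite coll_conjE a_eq cE bE dE submxK.
Qed.

End Minimality.

Lemma exists_unitmx_row (F : fieldType) N (y : 'rV[F]_(N + 1)) : y != 0 ->
  exists2 u, u \in unitmx & (row_mx 0 1%:M : 'rV_(N + 1)) *m u = y.
Proof.
move=> /rV0Pn [i yi].
pose s := tperm i (rshift N ord0); pose y' := y *m perm_mx s.
have y'0 : rsubmx y' 0 0 != 0.
  by rewrite mxE /y' /s -tpermV -col_permE mxE tpermR.
exists (block_mx 1%:M 0 (lsubmx y') (rsubmx y') *m perm_mx s).
  rewrite unitmx_mul unitmx_perm andbT unitmxE det_lblock det1 mul1r det_mx11.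
  by rewrite unitfE.
rewrite mulmxA mul_row_block !(mul0mx, mul1mx, add0r) hsubmxK -mulmxA.
by rewrite -perm_mxM tperm2 perm_mx1 mulmx1.
Qed.

Lemma prod_char_poly0 (R : comNzRingType) N (d : 'M[R]_N) (rs : seq R) :
  char_poly d = \prod_(r <- rs) ('X - r%:P) -> \prod_(r <- rs) (d - r%:M) = 0.
Proof.
case: N d => [|N] d rsE; first by rewrite [LHS]flatmx0 [RHS]flatmx0.
rewrite -[RHS](Cayley_Hamilton d) rsE rmorph_prod; apply: eq_bigr => r _.
by rewrite rmorphB /= horner_mx_X horner_mx_C.
Qed.

Lemma char_poly_roots (K : closedFieldType) N (d : 'M[K]_N) :
  exists rs, char_poly d = \prod_(r <- rs) ('X - r%:P).
Proof.
have [rs ->] := closed_field_poly_normal (char_poly d); exists rs.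
by rewrite (monicP (char_poly_monic d)) scale1r.
Qed.

(** The covectors killing all d^k c are stable under d. The factors d - r of the characteristic
    polynomial, applied in turn to one of them, lead to 0, and the last nonzero vector is an
    eigenvector. *)
Lemma unreachable_eigenvector (K : closedFieldType) alpha N (g : 'M[K]_(alpha + N)) :
  ~ reachable g -> exists (y : 'rV_N) x,
    [/\ y != 0, y *m drsubmx g = x *: y & y *m dlsubmx g = 0].
Proof.
move=> rg; have [y [y0 yc]] : exists y : 'rV_N, y != 0 /\
    forall k, y *m drsubmx g ^+ k *m dlsubmx g = 0.
  apply: contra_notP rg => noy y yc; apply/eqP; apply: contra_notT noy => y0.
  by exists y.
have [rs /prod_char_poly0 rs0] := char_poly_roots (drsubmx g).
have {rs0} : y *m \prod_(r <- rs) (drsubmx g - r%:M) = 0 by rewrite rs0 mulmx0.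
elim: rs y y0 yc => [|r rs IHrs] y y0 yc.
  by rewrite big_nil mulmx1 => /eqP; rewrite (negPf y0).
rewrite big_cons -mulmxE mulmxA; have [y'0 _|y'0] := eqVneq (y *m (drsubmx g - r%:M)) 0.
  exists y, r; split=> //; last by have := yc 0%N; rewrite expr0 mulmx1.
  by apply/eqP; rewrite -subr_eq0 -mul_mx_scalar -mulmxBr y'0.
apply: IHrs => // k; rewrite mulmxBr mul_mx_scalar !mulmxBl -!scalemxAl yc scaler0 subr0.
by have := yc k.+1; rewrite exprS -mulmxE mulmxA.
Qed.

(** * Splitting off eigenvalues by degeneration *)

Section Strip.
Variables (K : closedFieldType) (alpha : nat).

(** Multiplication by this element adds a decoupled state with eigenvalue x; for x = 1 it is the
    embedding into the next size. *)
Definition diag1 (x : K) : 'M[K]_(alpha + 1) := block_mx 1%:M 0 0 x%:M.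

Lemma coll_mul_diag1 N (g : 'M[K]_(alpha + N)) x : coll_mul g (diag1 x) =
  block_mx (ulsubmx g) (row_mx (ursubmx g) 0)
           (col_mx (dlsubmx g) 0) (block_mx (drsubmx g) 0 0 x%:M).
Proof.
rewrite /coll_mul /diag1 block_mxKul block_mxKur block_mxKdl block_mxKdr.
by rewrite !mulmx1 !mulmx0.
Qed.

Lemma coll_emb_diag1 N (g : 'M[K]_(alpha + N)) : coll_emb g = coll_mul g (diag1 1).
Proof. by rewrite coll_mul_diag1. Qed.

Lemma coll_mul_diag1_tr N (g : 'M[K]_(alpha + N)) x :
  (coll_mul g (diag1 x))^T = coll_mul g^T (diag1 x).
Proof.
rewrite !coll_mul_diag1 !(tr_block_mx, tr_row_mx, tr_col_mx) !trmx0 tr_scalar_mx.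
by rewrite trmx_ulsub trmx_ursub trmx_dlsub trmx_drsub.
Qed.

Lemma strip_unreachable N (g : 'M[K]_(alpha + (N + 1))) : ~ reachable g ->
  exists (g1 : 'M_(alpha + N)) x, coll_point g = coll_point (coll_mul g1 (diag1 x)).
Proof.
move=> /unreachable_eigenvector [y [x [y0 yd yc]]].
have [u uU uy] := exists_unitmx_row y0.
pose h := coll_conj u (invmx u) g.
have hc : dsubmx (dlsubmx h) = 0.
  rewrite -yc -uy -mulmxA /h coll_conjE block_mxKdl.
  by rewrite -{2}[u *m _]vsubmxK mul_row_col mul0mx mul1mx add0r.
have hd : dsubmx (drsubmx h) = row_mx 0 x%:M.
  transitivity (row_mx 0 1%:M *m (u *m drsubmx g *m invmx u)).
    rewrite /h coll_conjE block_mxKdr -{2}[_ *m invmx u]vsubmxK.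
    by rewrite mul_row_col mul0mx mul1mx add0r.
  rewrite !mulmxA uy yd -scalemxAl -uy mulmxK // scale_row_mx scaler0.
  by rewrite scalemx1.
pose g1 := block_mx (ulsubmx h) (lsubmx (ursubmx h)) (usubmx (dlsubmx h))
  (lsubmx (usubmx (drsubmx h))).
exists g1, x; pose C m n := map_mx (@polyC K) : 'M_(m, n) -> _.
(* For t != 0 this family is h conjugated by diag(1, 1/t), which scales the coupling to the last
   state by t; at t = 0 the last state is decoupled. *)
pose A : 'M[{poly K}]_(alpha + (N + 1)) :=
  block_mx (C _ _ (ulsubmx h))
    (row_mx (C _ _ (lsubmx (ursubmx h))) ('X *: C _ _ (rsubmx (ursubmx h))))
    (col_mx (C _ _ (usubmx (dlsubmx h))) 0)
    (block_mx (C _ _ (lsubmx (usubmx (drsubmx h))))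
       ('X *: C _ _ (rsubmx (usubmx (drsubmx h)))) 0 (C _ _ x%:M)).
have evC t m n (B : 'M_(m, n)) : map_mx (horner_eval t) (C _ _ B) = B.
  by apply/matrixP => i j; rewrite !mxE /horner_eval hornerC.
have evA t : map_mx (horner_eval t) A =
  block_mx (ulsubmx h) (row_mx (lsubmx (ursubmx h)) (t *: rsubmx (ursubmx h)))
    (col_mx (usubmx (dlsubmx h)) 0)
    (block_mx (lsubmx (usubmx (drsubmx h))) (t *: rsubmx (usubmx (drsubmx h))) 0 x%:M).
  rewrite !(map_block_mx, map_row_mx, map_col_mx) !map_mx0 !map_mxZ /= !evC.
  by rewrite /horner_eval hornerX.
rewrite -(coll_point_conj g uU) -/h -(@coll_point_limit _ _ _ A).
  congr coll_point; rewrite evA coll_mul_diag1 /g1.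
  by rewrite block_mxKul block_mxKur block_mxKdl block_mxKdr !scale0r.
move=> t t0; rewrite evA.
pose w : 'M[K]_(N + 1) := block_mx 1%:M 0 0 t^-1%:M.
pose w' : 'M[K]_(N + 1) := block_mx 1%:M 0 0 t%:M.
have w'w : w' *m w = 1%:M.
  rewrite mulmx_block !(mul1mx, mulmx1, mul0mx, mulmx0, addr0, add0r).
  by rewrite -scalar_mxM mulfV // -scalar_mx_block.
have [_ wU] := mulmx1_unit w'w.
have w'E : w' = invmx w by rewrite -[RHS]mul1mx -w'w mulmxK.
rewrite -(coll_point_conj h wU) -w'E coll_conjE; congr coll_point; congr block_mx.
- rewrite -[ursubmx h in RHS]hsubmxK mul_row_block.
  by rewrite !(mulmx1, mulmx0, addr0, add0r) mul_mx_scalar.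
- rewrite -[dlsubmx h in RHS]vsubmxK hc mul_block_col.
  by rewrite !(mul1mx, mul0mx, mulmx0, addr0, add0r).
- rewrite -[drsubmx h in RHS]vsubmxK hd -[usubmx (drsubmx h) in RHS]hsubmxK.
  rewrite -/(block_mx _ _ _ _) !mulmx_block.
  rewrite !(mul1mx, mulmx1, mul0mx, mulmx0, addr0, add0r) mul_mx_scalar.
  by rewrite -!scalar_mxM mulrAC mulVf // mul1r.
Qed.

Lemma strip_nonminimal N (g : 'M[K]_(alpha + (N + 1))) : ~ minimal g ->
  exists (g1 : 'M_(alpha + N)) x, coll_point g = coll_point (coll_mul g1 (diag1 x)).
Proof.
move=> mg; have [rg|] := pselect (reachable g); last exact: strip_unreachable.
have /strip_unreachable [g1 [x]] : ~ reachable g^T by move=> rgT; apply: mg.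
move=> /coll_point_tr; rewrite trmxK coll_mul_diag1_tr => ->.
by exists g1^T, x.
Qed.

Definition coll_rep_of N (g : 'M[K]_(alpha + N)) : coll_rep K alpha :=
  existT _ N (coll_point g).

Definition add_pole (x : K) (z : coll_rep K alpha) : coll_rep K alpha :=
  existT _ (tag z + 1)%N (coll_quot_mul (tagged z) (coll_point (diag1 x))).

Lemma add_pole_rep_of x N (g : 'M[K]_(alpha + N)) :
  add_pole x (coll_rep_of g) = coll_rep_of (coll_mul g (diag1 x)).
Proof. by congr existT; apply/coll_quot_eq/coll_quot_mul_point. Qed.

Lemma coll_step_rep_of N (g : 'M[K]_(alpha + N)) :
  coll_step (coll_rep_of g) = coll_rep_of (coll_emb g).
Proof. by congr existT; apply/coll_quot_eq/coll_quot_emb_point. Qed.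

Lemma coll_rep_of_surj (z : coll_rep K alpha) :
  exists N (g : 'M[K]_(alpha + N)), z = coll_rep_of g.
Proof. by case: z => N phi; have [g ->] := coll_quot_point phi; exists N, g. Qed.

Lemma strip_all N (g : 'M[K]_(alpha + N)) :
  exists M (h : 'M[K]_(alpha + M)) xs,
    minimal h /\ coll_rep_of g = foldr add_pole (coll_rep_of h) xs.
Proof.
elim: N g => [|N IHN] g.
  by exists 0%N, g, [::]; split=> //; split=> y _; rewrite [y]thinmx0.
rewrite -[N.+1]addn1 in g *; have [mg|] := pselect (minimal g).
  by exists (N + 1)%N, g, [::].
move=> /strip_nonminimal [g1 [x gE]]; have [M [h [xs [mh hE]]]] := IHN g1.
exists M, h, (x :: xs); split=> //=.
by rewrite -hE add_pole_rep_of /coll_rep_of gE.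
Qed.

Lemma add_poleC x y z : add_pole x (add_pole y z) = add_pole y (add_pole x z).
Proof.
have [N [g ->]] := coll_rep_of_surj z; rewrite !add_pole_rep_of; congr existT.
(* The permutation exchanging the two added states. *)
pose w : 'M[K]_((N + 1) + 1) :=
  block_mx (block_mx 1%:M 0 0 0) (col_mx 0 1%:M) (row_mx 0 1%:M) 0.
have simp := (mulmx_block, mul_col_row, mul_row_block, mul_block_col, mul_row_col,
  mul1mx, mulmx1, mul0mx, mulmx0, addr0, add0r, mul_col_mx, mul_mx_row,
  row_mx0, col_mx0, add_block_mx, add_row_mx, add_col_mx).
have ww : w *m w = 1%:M.
  by rewrite /w !simp -!scalar_mx_block.
have [wU _] := mulmx1_unit ww.
have wV : invmx w = w by rewrite -[LHS]mulmx1 -ww mulKmx.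
rewrite -[RHS](coll_point_conj _ wU) wV; congr coll_point.
rewrite coll_conjE !coll_mul_diag1 !(block_mxKul, block_mxKur, block_mxKdl, block_mxKdr).
rewrite /w !simp; do 2!congr block_mx.
by rewrite -[X in row_mx X _](col_mx0 _ N 1) -block_mxEh !simp.
Qed.

Lemma perm_foldr_add_pole xs ys z : perm_eq xs ys ->
  foldr add_pole z xs = foldr add_pole z ys.
Proof.
elim: xs ys => [|x xs IHxs] ys; first by rewrite perm_sym => /perm_nilP ->.
move=> xys; have : x \in ys by rewrite -(perm_mem xys) mem_head.
move=> /splitPr ysE; case: ysE xys => ys1 ys2.
rewrite -(cat1s x ys2) perm_sym perm_catCA perm_sym perm_cons => xys.
rewrite /= (IHxs (ys1 ++ ys2)); last by [].
by elim: ys1 {xys} => //= y ys1 <-; rewrite add_poleC.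
Qed.

End Strip.

Lemma char_poly_ublock (R : comNzRingType) N M (A : 'M[R]_N) B (D : 'M[R]_M) :
  char_poly (block_mx A B 0 D) = char_poly A * char_poly D.
Proof.
rewrite /char_poly /char_poly_mx map_block_mx scalar_mx_block.
rewrite opp_block_mx add_block_mx map_mx0 oppr0 !add0r.
by rewrite det_ublock.
Qed.

Lemma char_poly_coll_mul (R : comNzRingType) alpha N M (g : 'M[R]_(alpha + N))
    (h : 'M[R]_(alpha + M)) :
  char_poly (drsubmx (coll_mul g h)) = char_poly (drsubmx g) * char_poly (drsubmx h).
Proof. by rewrite /coll_mul block_mxKdr char_poly_ublock. Qed.

Section RepEquality.
Variables (K : closedFieldType) (alpha : nat).
Local Notation diag1 := (@diag1 K alpha).

Lemma char_poly_diag1 x : char_poly (drsubmx (diag1 x)) = 'X - x%:P.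
Proof.
by rewrite block_mxKdr /char_poly det_mx11 /char_poly_mx !mxE eqxx.
Qed.

Lemma moment_diag1 N (g : 'M[K]_(alpha + N)) x k :
  moment (coll_mul g (diag1 x)) k = moment g k.
Proof.
rewrite coll_mul_diag1 /moment block_mxKur block_mxKdl block_mxKdr.
have -> : block_mx (drsubmx g) 0 0 (x%:M : 'M_1) ^+ k =
    block_mx (drsubmx g ^+ k) 0 0 (x%:M ^+ k).
  elim: k => [|k IHk]; first by rewrite !expr0 -[LHS]/(1%:M) scalar_mx_block.
  rewrite !exprS IHk -mulmxE mulmx_block.
  by rewrite !(mul0mx, mulmx0, addr0, add0r).
by rewrite mul_row_block mul_row_col !(mul0mx, mulmx0, addr0, add0r).
Qed.

Lemma coll_rep_of_eqP N M (g : 'M[K]_(alpha + N)) (h : 'M[K]_(alpha + M)) :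
  coll_rep_of g = coll_rep_of h ->
  [/\ ulsubmx g = ulsubmx h, forall k, moment g k = moment h k
    & char_poly (drsubmx g) = char_poly (drsubmx h)].
Proof.
move=> E; have e : N = M := congr1 tag E; case: M / e in h E *.
have {}E : coll_point g = coll_point h.
  exact: (Eqdep_dec.inj_pair2_eq_dec _ PeanoNat.Nat.eq_dec _ _ _ _ E).
split=> [|k|]; first exact: coll_point_ulsubmx.
  exact: coll_point_moment.
exact: coll_point_char_poly.
Qed.

Lemma foldr_add_pole_rep_of N (g : 'M[K]_(alpha + N)) xs :
  exists M (h : 'M[K]_(alpha + M)),
  [/\ foldr (@add_pole K alpha) (coll_rep_of g) xs = coll_rep_of h,
     ulsubmx h = ulsubmx g, forall k, moment h k = moment g k
   & char_poly (drsubmx h) = char_poly (drsubmx g) * \prod_(x <- xs) ('X - x%:P)].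
Proof.
elim: xs => [|x xs [M [h [hE ah mh ch]]]] /=.
  by exists N, g; rewrite big_nil mulr1.
exists (M + 1)%N, (coll_mul h (diag1 x)); split.
- by rewrite hE add_pole_rep_of.
- by rewrite coll_mul_diag1 block_mxKul.
- by move=> k; rewrite moment_diag1.
- by rewrite char_poly_coll_mul char_poly_diag1 ch big_cons -mulrA [_ * ('X - _)]mulrC.
Qed.

Lemma coll_rep_of_eq N M (g : 'M[K]_(alpha + N)) (h : 'M[K]_(alpha + M)) :
  ulsubmx g = ulsubmx h -> (forall k, moment g k = moment h k) ->
  char_poly (drsubmx g) = char_poly (drsubmx h) -> coll_rep_of g = coll_rep_of h.
Proof.
move=> a_eq m_eq c_eq.
have [n [g1 [xs [ming gE]]]] := strip_all g.
have [m [h1 [ys [minh hE]]]] := strip_all h.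
have [Ng [g2 [g2E ag mg cg]]] := foldr_add_pole_rep_of g1 xs.
have [Nh [h2 [h2E ah mh ch]]] := foldr_add_pole_rep_of h1 ys.
have [ag2 mg2 cg2] := coll_rep_of_eqP (etrans gE g2E).
have [ah2 mh2 ch2] := coll_rep_of_eqP (etrans hE h2E).
have m1 k : moment g1 k = moment h1 k by rewrite -mg -mh -mg2 -mh2.
have e := minimal_size ming minh m1; case: m / e in h1 hE h2E ah mh ch minh m1 *.
have [|u uU h1E] := minimal_conj ming minh _ m1; first by rewrite -ag -ah -ag2 -ah2.
have gh1 : coll_rep_of g1 = coll_rep_of h1.
  by rewrite /coll_rep_of h1E coll_point_conj.
(* Dividing the equal characteristic polynomials by that of the common minimal part leaves equal
   multisets of split-off eigenvalues. *)
rewrite gE hE gh1; apply/perm_foldr_add_pole/prod_XsubC_eq.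
have cN0 : char_poly (drsubmx g1) != 0 by rewrite monic_neq0 // char_poly_monic.
apply: (mulfI cN0); rewrite -cg -cg2 c_eq ch2 ch.
by have [_ _ ->] := coll_rep_of_eqP gh1.
Qed.

End RepEquality.

(** * Exceptional divisors and characteristic functions *)

Section Fractions.
Variable R : idomainType.

Lemma frac_reprE (x : {fraction R}) : x = (\n_(repr x))%:F / (\d_(repr x))%:F.
Proof.
have dN0 : (\d_(repr x))%:F != 0 by rewrite tofrac_eq0 denom_ratioP.
apply: (mulIf dN0); rewrite divfK //.
have tofracE (a : R) : a%:F = \pi_({fraction R}) (Ratio a 1).
  by rewrite /FracField.tofrac; unlock.
rewrite !tofracE -{1}[x]reprK -[LHS]FracField.pi_mul; apply/eqmodP.
rewrite /= FracField.equivfE /FracField.mulf.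
rewrite !numden_Ratio ?oner_neq0 ?mulf_neq0 ?denom_ratioP //.
- by rewrite !mulr1 mulrC.
- exact: oner_neq0.
- exact: oner_neq0.
Qed.

End Fractions.

Section PolyMultiplicity.
Variable K : closedFieldType.

Lemma mup_XsubC (a r : K) : mup a ('X - r%:P) = (r == a).
Proof. by rewrite -[_ - _]expr1 mup_XsubCX; case: eqP. Qed.

Lemma dvdp_prod_XsubC_mup (rs : seq K) (P : {poly K}) :
  P != 0 -> (forall a, count_mem a rs <= mup a P)%N -> \prod_(r <- rs) ('X - r%:P) %| P.
Proof.
elim: rs P => [|r rs IHrs] P P0 rsP; first by rewrite big_nil dvd1p.
have : 'X - r%:P %| P by rewrite XsubC_dvd // (leq_trans _ (rsP r)) //= eqxx.
move=> /dvdpP [Q PE]; rewrite big_cons PE mulrC dvdp_mul // IHrs //.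
  by apply: contraNneq P0 => Q0; rewrite PE Q0 mul0r.
move=> a; have := rsP a; rewrite PE mupM ?polyXsubC_eq0 //=; last first.
  by apply: contraNneq P0 => Q0; rewrite PE Q0 mul0r.
by rewrite mup_XsubC [(mup _ _ + _)%N]addnC leq_add2l.
Qed.

Lemma dvdp_mup (d P : {poly K}) : d != 0 -> P != 0 ->
  (forall a, mup a d <= mup a P)%N -> d %| P.
Proof.
move=> d0 P0 dP; have [rs dE] := closed_field_poly_normal d.
rewrite dE dvdpZl ?lead_coef_eq0 //; apply: dvdp_prod_XsubC_mup => // a.
rewrite -mu_prod_XsubC (leq_trans _ (dP a)) // {1}dE -mul_polyC mupMr //.
by rewrite rootC lead_coef_eq0.
Qed.

(* The polynomial det(1 - lambda d), where rs is the spectrum of d. *)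
Definition exc_prod (rs : seq K) : {poly K} := \prod_(r <- rs) (1 - r%:P * 'X).

Lemma exc_prod0 rs : (exc_prod rs).[0] = 1.
Proof.
rewrite /exc_prod horner_prod big1 // => r _.
by rewrite !hornerE ?mulr0 ?subr0.
Qed.

Lemma exc_prod_neq0 rs : exc_prod rs != 0.
Proof.
by apply/eqP => /(congr1 (horner^~ 0)); rewrite exc_prod0 horner0; apply/eqP/oner_neq0.
Qed.

Lemma mup_exc_prod rs a : mup a (exc_prod rs) = if a == 0 then 0%N else count_mem a^-1 rs.
Proof.
case: eqP => [->|/eqP a0].
  by apply: mupNroot; rewrite /root exc_prod0 oner_neq0.
elim: rs => [|r rs IHrs]; first by rewrite /exc_prod big_nil mupNroot // root1.
have E : exc_prod (r :: rs) = (1 - r%:P * 'X) * exc_prod rs by rewrite /exc_prod big_cons.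
have f0 : 1 - r%:P * 'X != 0.
  by move: (exc_prod_neq0 (r :: rs)); rewrite E mulf_eq0 negb_or => /andP [].
rewrite E mupM ?exc_prod_neq0 // IHrs /=; congr (_ + _)%N.
have [->|r0] := eqVneq r 0.
  by rewrite mul0r subr0 mupNroot ?root1 // eq_sym (negPf (invr_neq0 a0)).
have -> : 1 - r%:P * 'X = (- r)%:P * ('X - (r^-1)%:P).
  by rewrite mulrBr -polyCM mulNr mulfV // !polyCN mulNr opprK addrC.
rewrite mupMr; last by rewrite rootC oppr_eq0.
rewrite mup_XsubC.
by rewrite -(inj_eq invr_inj) invrK eq_sym.
Qed.

Lemma size_exc_prod rs : (size (exc_prod rs)).-1 = (size rs - count_mem 0%R rs)%N.
Proof.
elim: rs => [|r rs IHrs]; first by rewrite /exc_prod big_nil size_poly1.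
have E : exc_prod (r :: rs) = (1 - r%:P * 'X) * exc_prod rs by rewrite /exc_prod big_cons.
have [r0|r0] := eqVneq r 0.
  by rewrite E r0 mul0r subr0 mul1r IHrs /= eqxx subSS.
have s2 : size (1 - r%:P * 'X) = 2%N.
  rewrite addrC size_polyDl size_polyN mul_polyC size_scale ?size_polyX //.
  by rewrite size_poly1.
rewrite E size_mul ?exc_prod_neq0 ?s2 //; last by rewrite -size_poly_eq0 s2.
rewrite /= (negPf r0) add0n subSn ?count_size // -IHrs.
by have := size_poly_gt0 (exc_prod rs); rewrite exc_prod_neq0; case: size.
Qed.

End PolyMultiplicity.

Section Exceptional.
Variables (K : closedFieldType) (alpha N : nat) (g : 'M[K]_(alpha + N)).

(** For t != 0, det(1 - t d) is t^N times the characteristic polynomial at 1/t, and polynomials that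
    agree off 0 are equal. *)
Lemma exc_polyE rs : char_poly (drsubmx g) = \prod_(r <- rs) ('X - r%:P) ->
  exc_poly g = exc_prod rs.
Proof.
move=> rsE; have sN : size rs = N.
  by have := size_char_poly (drsubmx g); rewrite rsE size_prod_XsubC => -[].
have : (exc_poly g - exc_prod rs) * 'X = 0.
  apply: poly_eq0_horner => t; rewrite !hornerE.
  have [->|t0] := eqVneq t 0; first by rewrite mulr0.
  suff -> : (exc_poly g).[t] = (exc_prod rs).[t] by rewrite subrr mul0r.
  have -> : (exc_poly g).[t] = \det (1%:M - t *: drsubmx g).
    rewrite -[LHS]/(horner_eval t _) -det_map_mx; congr (\det _); apply/matrixP => i j.
    by rewrite !mxE rmorphB rmorphM rmorph_nat /= /horner_eval hornerX hornerC.
  have -> : 1%:M - t *: drsubmx g = t *: (t^-1%:M - drsubmx g).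
    by rewrite scalerBr scale_scalar_mx mulfV.
  rewrite detZ.
  have -> : \det (t^-1%:M - drsubmx g) = (char_poly (drsubmx g)).[t^-1].
    rewrite -[RHS]/(horner_eval t^-1 _) -det_map_mx; congr (\det _); apply/matrixP => i j.
    by rewrite !mxE rmorphB rmorphMn /= /horner_eval hornerX hornerC.
  rewrite rsE !horner_prod -sN; elim: (rs) => [|r s IHs]; first by rewrite !big_nil mulr1.
  rewrite !big_cons /= -IHs exprS mulrACA !hornerE; congr (_ * _).
  by rewrite mulrBr mulfV // mulrC.
by move/eqP; rewrite mulf_eq0 polyX_eq0 orbF subr_eq0 => /eqP.
Qed.

(** The coordinate s = 1 / lambda, in which the exceptional divisor is the spectrum of d. The value
    0 at [Some 0] is a default that collides with that at infinity, so lambda = 0 is treated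
    apart. *)
Definition pole_inv (x : proj_line K) : K := if x is Some a then a^-1 else 0.

Lemma exc_divE rs x : char_poly (drsubmx g) = \prod_(r <- rs) ('X - r%:P) ->
  exc_div g x = if x == Some 0 then 0%N else count_mem (pole_inv x) rs.
Proof.
move=> rsE; have sN : size rs = N.
  by have := size_char_poly (drsubmx g); rewrite rsE size_prod_XsubC => -[].
rewrite /exc_div (exc_polyE rsE); case: x => [a|] /=; first by rewrite mup_exc_prod.
by rewrite size_exc_prod -sN subKn // count_size.
Qed.

End Exceptional.

(** * Rational functions regular at lambda = 0 *)

Section RationalFunctions.
Variable K : closedFieldType.
Local Notation F := (ratfun K).
Local Notation "'l" := (rat_lambda K).

HB.instance Definition _ :=
  GRing.RMorphism.copy (@rat_const K) (@FracField.tofrac {poly K} \o polyC).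

Lemma rat_lambda_neq0 : 'l != 0 :> F.
Proof. by rewrite tofrac_eq0 polyX_eq0. Qed.

Lemma frac_eq (n d n' d' : {poly K}) : d != 0 -> d' != 0 ->
  n%:F / d%:F = n'%:F / d'%:F :> F -> n * d' = n' * d.
Proof.
move=> d0 d'0 /eqP; rewrite eqr_div ?tofrac_eq0 // -!tofracM tofrac_eq.
by move/eqP.
Qed.

(** Cross-multiplying two representatives shows that the difference of multiplicities, hence its
    truncation, is independent of the choice; at infinity degrees take the place of
    multiplicities. *)
Lemma den_multE (n d : {poly K}) x : n != 0 -> d != 0 ->
  den_mult (n%:F / d%:F : F) x =
  if x is Some a then (mup a d - mup a n)%N else ((size n).-1 - (size d).-1)%N.
Proof.
move=> n0 d0; set r : F := _ / _.
have r0 : r != 0 by rewrite mulf_neq0 ?invr_eq0 ?tofrac_eq0.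
rewrite /den_mult (negPf r0); set n' := \n_(repr r); set d' := \d_(repr r).
have d'0 : d' != 0 by exact: denom_ratioP.
have rE : r = n'%:F / d'%:F by exact: frac_reprE.
have n'0 : n' != 0.
  by apply: contraNneq r0 => n'0; rewrite rE n'0 tofrac0 mul0r.
have /esym E := frac_eq d0 d'0 rE.
case: x => [a|].
  by have := congr1 (mup a) E; rewrite !mupM //; lia.
have := congr1 (fun p : {poly K} => size p) E; rewrite !size_mul //.
move: n0 d0 n'0 d'0; rewrite -!size_poly_gt0.
by move: (size n) (size d) (size n') (size d') => [|?] [|?] [|?] [|?] //=; lia.
Qed.

Definition reg0 (x : F) := exists n d : {poly K}, d.[0] != 0 /\ x = n%:F / d%:F.

Lemma horner0_neq0 (d : {poly K}) : d.[0] != 0 -> d%:F != 0 :> F.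
Proof. by rewrite tofrac_eq0; apply: contraNneq => ->; rewrite horner0. Qed.

Lemma reg0_frac (n d : {poly K}) : d.[0] != 0 -> reg0 (n%:F / d%:F).
Proof. by exists n, d. Qed.

Lemma reg0_poly (n : {poly K}) : reg0 n%:F.
Proof. by exists n, 1; rewrite hornerC oner_neq0 tofrac1 divr1. Qed.

Lemma reg0_const c : reg0 (rat_const c). Proof. exact: reg0_poly. Qed.

Lemma reg0D x y : reg0 x -> reg0 y -> reg0 (x + y).
Proof.
move=> [n [d [d0 ->]]] [n' [d' [d'0 ->]]]; exists (n * d' + n' * d), (d * d').
rewrite hornerM mulf_neq0 //; split=> //.
by rewrite addf_div ?horner0_neq0 // tofracD !tofracM.
Qed.

Lemma reg0M x y : reg0 x -> reg0 y -> reg0 (x * y).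
Proof.
move=> [n [d [d0 ->]]] [n' [d' [d'0 ->]]]; exists (n * n'), (d * d').
by rewrite hornerM mulf_neq0 // !tofracM mulf_div.
Qed.

Lemma reg0N x : reg0 x -> reg0 (- x).
Proof. by move=> rx; rewrite -mulN1r -tofrac1 -tofracN; apply/reg0M/rx/reg0_poly. Qed.

Lemma reg0B x y : reg0 x -> reg0 y -> reg0 (x - y).
Proof. by move=> rx ry; apply/reg0D/reg0N. Qed.

Lemma reg0_sum I (r : seq I) (A : pred I) (f : I -> F) :
  (forall i, A i -> reg0 (f i)) -> reg0 (\sum_(i <- r | A i) f i).
Proof.
move=> rf; elim/big_ind: _ => //; last exact: reg0D.
by rewrite -tofrac0; apply: reg0_poly.
Qed.

Lemma reg0_mulmx m n p (A : 'M[F]_(m, n)) (B : 'M_(n, p)) :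
  (forall i j, reg0 (A i j)) -> (forall i j, reg0 (B i j)) ->
  forall i j, reg0 ((A *m B) i j).
Proof. by move=> rA rB i j; rewrite mxE; apply: reg0_sum => k _; apply: reg0M. Qed.

Lemma reg0_split x : reg0 x -> exists c y, reg0 y /\ x = rat_const c + 'l * y.
Proof.
move=> [n [d [d0 ->]]]; pose c := n.[0] / d.[0].
have /factor_theorem [q qE] : root (n - c%:P * d) 0.
  by rewrite /root !hornerE divfK // subrr.
exists c, (q%:F / d%:F); split; first exact: reg0_frac.
rewrite mulrA -tofracM [_ * q]mulrC -['X](subr0) -polyC0 -qE tofracB tofracM.
by rewrite mulrBl mulfK ?horner0_neq0 // addrC subrK.
Qed.

Lemma reg0_const_eq0 c y : reg0 y -> rat_const c + 'l * y = 0 -> c = 0.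
Proof.
move=> [n [d [d0 ->]]] E; have : (c%:P * d + 'X * n)%:F = 0 :> F.
  rewrite tofracD !tofracM -[RHS](mul0r d%:F) -E mulrDl; congr (_ + _).
  by rewrite mulrA divfK ?horner0_neq0.
move/eqP; rewrite tofrac_eq0 => /eqP /(congr1 (horner^~ 0)).
by rewrite !hornerE ?mul0r ?addr0 => /eqP; rewrite mulf_eq0 (negPf d0) orbF => /eqP.
Qed.

(** Written with a denominator nonzero at 0, a nonzero function vanishes there to an order below the
    size of its numerator n, which contradicts the case k = [size n]. *)
Lemma reg0_lambdaX_eq0 x : (forall k, exists2 y, reg0 y & x = 'l ^+ k * y) -> x = 0.
Proof.
move=> xk; have [_ [n [d [d0 ->]]] xE] := xk 0%N; rewrite expr0 mul1r in xE.
have [n0|n0] := eqVneq n 0; first by rewrite xE n0 tofrac0 mul0r.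
have [_ [n' [d' [d'0 ->]]] xE'] := xk (size n).
have d'N0 : d' != 0 by apply: contraNneq d'0 => ->; rewrite horner0.
have dN0 : d != 0 by apply: contraNneq d0 => ->; rewrite horner0.
have E : n * d' = 'X^(size n) * n' * d.
  by apply: frac_eq => //; rewrite -xE xE' mulrA /rat_lambda -tofracXn -tofracM.
have n'0 : n' != 0.
  apply: contraNneq n0 => n'0; move/eqP: E.
  by rewrite n'0 mulr0 mul0r mulf_eq0 (negPf d'N0) orbF.
have := congr1 (mup 0) E; rewrite !mupM ?mulf_neq0 ?expf_neq0 ?polyX_eq0 //.
rewrite (@mupNroot _ _ d') // (@mupNroot _ _ d) // !addn0.
have := mup_XsubCX (size n) 0 (0 : K); rewrite subr0 eqxx => -> sE.
have : (mup 0 n < size n)%N.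
  rewrite mup_ltn // subr0; apply/negP => /dvdp_leq -/(_ n0).
  by rewrite size_polyXn ltnn.
by rewrite sE; lia.
Qed.

End RationalFunctions.

Lemma invmx_uniq (R : comUnitRingType) n (A B : 'M[R]_n) : A *m B = 1%:M -> invmx A = B.
Proof.
move=> AB; have [uA _] := mulmx1_unit AB.
by rewrite -[RHS](mulKmx uA) AB mulmx1.
Qed.

Section CharacteristicFunctions.
Variables (K : closedFieldType) (alpha : nat).
Local Notation F := (ratfun K).
Local Notation "'l" := (rat_lambda K).
Local Notation C := (map_mx (@rat_const K)).

Definition res_mx N (d : 'M[K]_N) : 'M[F]_N := 1%:M - 'l *: C d.

Lemma res_mxE N (d : 'M[K]_N) :
  res_mx d = map_mx (@FracField.tofrac _) (1%:M - 'X *: map_mx polyC d).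
Proof.
by rewrite map_mxB map_mx1 map_mxZ -map_mx_comp.
Qed.

Lemma res_mx_unit N (d : 'M[K]_N) : res_mx d \in unitmx.
Proof.
rewrite unitmxE unitfE res_mxE det_map_mx tofrac_eq0.
have [rs rsE] := char_poly_roots d.
have -> : \det (1%:M - 'X *: map_mx polyC d) = exc_poly (block_mx 0 0 0 d : 'M_(0 + N)).
  by rewrite /exc_poly block_mxKdr.
by rewrite (@exc_polyE _ _ _ _ rs) ?block_mxKdr // exc_prod_neq0.
Qed.

Lemma char_funE N (g : 'M[K]_(alpha + N)) : char_fun g =
  C (ulsubmx g) + 'l *: (C (ursubmx g) *m invmx (res_mx (drsubmx g)) *m C (dlsubmx g)).
Proof. by []. Qed.

Lemma char_fun_mul N1 N2 (g : 'M[K]_(alpha + N1)) (h : 'M[K]_(alpha + N2)) :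
  char_fun (coll_mul g h) = char_fun g *m char_fun h.
Proof.
rewrite !char_funE /coll_mul !(block_mxKul, block_mxKur, block_mxKdl, block_mxKdr).
set a := C (ulsubmx g); set b := C (ursubmx g); set c := C (dlsubmx g).
set p := C (ulsubmx h); set q := C (ursubmx h); set r := C (dlsubmx h).
set P := invmx (res_mx (drsubmx g)); set Q := invmx (res_mx (drsubmx h)).
(* The d block of the product is upper triangular; the off-diagonal block of its resolvent yields
   the cross term in the product of the characteristic functions. *)
have -> : invmx (res_mx (block_mx (drsubmx g) (dlsubmx g *m ursubmx h) 0 (drsubmx h))) =
    block_mx P ('l *: (P *m c *m q *m Q)) 0 Q.
  apply: invmx_uniq; rewrite /res_mx map_block_mx scale_block_mx.
  rewrite scalar_mx_block opp_block_mx add_block_mx -/(res_mx _) -/(res_mx _).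
  rewrite map_mx0 scaler0 oppr0 !add0r mulmx_block !(mul0mx, mulmx0, addr0, add0r).
  rewrite !mulmxV ?res_mx_unit // -scalemxAr !mulmxA mulmxV ?res_mx_unit // mul1mx.
  by rewrite mulNmx -scalemxAl map_mxM subrr.
rewrite map_row_mx map_col_mx !map_mxM -/a -/b -/c -/p -/q -/r.
rewrite mul_row_block mul_row_col mulmx0 addr0 mulmxDr mulmxDl.
have -> : b *m ('l *: (P *m c *m q *m Q)) *m r = 'l *: (b *m P *m c *m (q *m Q *m r)).
  by rewrite -scalemxAr -scalemxAl !mulmxA.
rewrite -[in RHS]scalemxAr [in RHS]mulmxDl -[in RHS]scalemxAl -addrA.
rewrite [(a + _) *m (q *m Q *m r)]mulmxDl -[in RHS]scalemxAl -scalerDr.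
by congr (_ + _ *: (_ + _)); rewrite ?mulmxA // addrC.
Qed.

Lemma char_fun_diag1 x : char_fun (@diag1 K alpha x) = 1%:M.
Proof.
rewrite char_funE !(block_mxKul, block_mxKur, block_mxKdl, block_mxKdr).
by rewrite map_mx1 !map_mx0 !mul0mx scaler0 addr0.
Qed.

(** The Taylor remainder: chi is a, plus the terms lambda^(i+1) b d^i c for i < k, plus lambda^(k+1)
    times [tail_fun g k]. *)
Definition tail_fun N (g : 'M[K]_(alpha + N)) k : 'M[F]_alpha :=
  C (ursubmx g) *m invmx (res_mx (drsubmx g)) *m C (drsubmx g ^+ k *m dlsubmx g).

Lemma char_fun_tail N (g : 'M[K]_(alpha + N)) :
  char_fun g = C (ulsubmx g) + 'l *: tail_fun g 0.
Proof. by rewrite /tail_fun expr0 mul1mx. Qed.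

Lemma tail_funS N (g : 'M[K]_(alpha + N)) k :
  tail_fun g k = C (moment g k) + 'l *: tail_fun g k.+1.
Proof.
have VE : invmx (res_mx (drsubmx g)) =
    1%:M + 'l *: (invmx (res_mx (drsubmx g)) *m C (drsubmx g)).
  apply/eqP; rewrite -subr_eq; apply/eqP.
  rewrite -[RHS](mulVmx (res_mx_unit (drsubmx g))) {3}/res_mx.
  by rewrite mulmxBr mulmx1 -scalemxAr.
rewrite /tail_fun {1}VE mulmxDr mulmx1 mulmxDl /moment !map_mxM mulmxA; congr (_ + _).
by rewrite exprS map_mxM -scalemxAr -scalemxAl !mulmxA.
Qed.

Lemma reg0_res_inv N (d : 'M[K]_N) i j : reg0 (invmx (res_mx d) i j).
Proof.
have uU := res_mx_unit d; rewrite /invmx uU mxE res_mxE det_map_mx.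
rewrite -map_mx_adj mxE mulrC; apply: reg0_frac.
have [rs rsE] := char_poly_roots d.
have -> : \det (1%:M - 'X *: map_mx polyC d) = exc_poly (block_mx 0 0 0 d : 'M_(0 + N)).
  by rewrite /exc_poly block_mxKdr.
by rewrite (@exc_polyE _ _ _ _ rs) ?block_mxKdr // exc_prod0 oner_neq0.
Qed.

Lemma reg0_tail_fun N (g : 'M[K]_(alpha + N)) k i j : reg0 (tail_fun g k i j).
Proof.
apply: reg0_mulmx => [|? ?]; last by rewrite mxE; apply: reg0_const.
apply: reg0_mulmx => ? ?; last exact: reg0_res_inv.
by rewrite mxE; apply: reg0_const.
Qed.

Lemma const_lambda_inj (A B : 'M[K]_alpha) (X Y : 'M[F]_alpha) :
  (forall i j, reg0 (X i j)) -> (forall i j, reg0 (Y i j)) ->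
  C A + 'l *: X = C B + 'l *: Y -> A = B /\ X = Y.
Proof.
move=> rX rY E; have AB : A = B.
  apply/matrixP => i j; apply/eqP; rewrite -subr_eq0; apply/eqP.
  apply: (reg0_const_eq0 (y := X i j - Y i j)); first exact: reg0B.
  have := congr1 (fun M : 'M__ => M i j) E; rewrite !mxE => /eqP.
  by rewrite -subr_eq0 => /eqP <-; rewrite rmorphB mulrBr opprD addrACA.
split=> //; move: E; rewrite AB => /addrI /(congr1 ( *:%R 'l^-1)).
by rewrite !scalerA mulVf ?rat_lambda_neq0 // !scale1r.
Qed.

Lemma char_fun_inj N M (g : 'M[K]_(alpha + N)) (h : 'M[K]_(alpha + M)) :
  char_fun g = char_fun h ->
  ulsubmx g = ulsubmx h /\ forall k, moment g k = moment h k.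
Proof.
rewrite !char_fun_tail => E.
have [-> t0] := const_lambda_inj (reg0_tail_fun g 0) (reg0_tail_fun h 0) E.
have mt k : tail_fun g k = tail_fun h k -> moment g k = moment h k /\
    tail_fun g k.+1 = tail_fun h k.+1.
  rewrite tail_funS [tail_fun h k]tail_funS.
  exact: const_lambda_inj (reg0_tail_fun g _) (reg0_tail_fun h _).
split=> // k; suff /mt [] : tail_fun g k = tail_fun h k by [].
by elim: k => // k /mt [].
Qed.

(** With equal moments the remainders [tail_fun _ 0] differ by lambda^k times a regular function for
    every k, hence not at all. *)
Lemma eq_char_fun N M (g : 'M[K]_(alpha + N)) (h : 'M[K]_(alpha + M)) :
  ulsubmx g = ulsubmx h -> (forall k, moment g k = moment h k) ->
  char_fun g = char_fun h.
Proof.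
move=> a_eq m_eq; rewrite !char_fun_tail a_eq; congr (_ + _ *: _).
apply/matrixP => i j; apply/eqP; rewrite -subr_eq0; apply/eqP/reg0_lambdaX_eq0 => k.
exists (tail_fun g k i j - tail_fun h k i j); first by apply: reg0B; apply: reg0_tail_fun.
elim: k => [|k ->]; first by rewrite expr0 mul1r.
have tE M' (z : 'M[K]_(alpha + M')) : tail_fun z k i j =
    rat_const (moment z k i j) + 'l * tail_fun z k.+1 i j.
  by rewrite tail_funS [LHS]mxE [X in X + _]mxE [X in _ + X]mxE.
rewrite !tE m_eq opprD addrACA subrr add0r.
by rewrite -mulrBr exprSr mulrA.
Qed.

End CharacteristicFunctions.

(** * Denominators of the minors of a characteristic function *)

Section DetSize.
Variable R : comNzRingType.

Lemma size_det_leq n (w : 'I_n -> nat) (A : 'M[{poly R}]_n) :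
  (forall i j, size (A i j) <= (w i).+1)%N -> (size (\det A) <= (\sum_i w i).+1)%N.
Proof.
move=> Aw; rewrite /determinant (leq_trans (size_sum _ _ _)) //.
apply/bigmax_leqP => s _; rewrite -signr_odd.
have -> : size ((-1) ^+ odd s * \prod_i A i (s i)) = size (\prod_i A i (s i)).
  by rewrite mulr_sign; case: odd; rewrite ?size_polyN.
rewrite (leq_trans (size_poly_prod_leq _ _)) // leq_subLR.
rewrite cardE size_enum_ord [X in (_ <= X)%N]addnS ltnS.
apply: leq_trans (leq_sum _ _) _; first by move=> i _; exact: Aw.
rewrite (eq_bigr (fun i => 1 + w i)%N) // big_split /= sum_nat_const card_ord muln1.
done.
Qed.

End DetSize.

Section MinorBound.
Variable K : closedFieldType.
Local Notation F := (ratfun K).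
Local Notation "'l" := (rat_lambda K).
Local Notation C := (map_mx (@rat_const K)).
Local Notation P := (map_mx (@polyC K)).
Local Notation T := (map_mx (@FracField.tofrac {poly K})).

(** By the Schur complement, u is the determinant of (a, b; -lambda c, 1 - lambda d). Its degree is
    at most N because lambda occurs only in the last N rows; this bound controls the pole at
    infinity. *)
Lemma det_char_fun alpha N (g : 'M[K]_(alpha + N)) :
  exists2 u : {poly K}, (size u <= N.+1)%N & u%:F = \det (char_fun g) * (exc_poly g)%:F.
Proof.
pose U : 'M[{poly K}]_(alpha + N) :=
  block_mx (P (ulsubmx g)) (P (ursubmx g)) (- ('X *: P (dlsubmx g)))
    (1%:M - 'X *: P (drsubmx g)).
have PE m n (A : 'M[K]_(m, n)) : T (P A) = C A by rewrite -map_mx_comp.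
exists (\det U).
  pose w (i : 'I_(alpha + N)) := if split i is inl _ then 0%N else 1%N.
  have wN : (\sum_i w i = N)%N.
    rewrite big_split_ord /= big1; last by move=> i _; rewrite /w (unsplitK (inl i)).
    rewrite (eq_bigr (fun=> 1%N)); last by move=> i _; rewrite /w (unsplitK (inr i)).
    by rewrite sum1_card card_ord.
  rewrite -[X in (_ <= X.+1)%N]wN; apply: size_det_leq => i j.
  rewrite /U /w !mxE; case: (split i) => i'; rewrite !mxE;
    case: (split j) => j'; rewrite !mxE.
  - exact: size_polyC_leq1.
  - exact: size_polyC_leq1.
  - by rewrite size_polyN mulrC mul_polyC (leq_trans (size_scale_leq _ _)) // size_polyX.
  - rewrite (leq_trans (size_polyD _ _)) // geq_max size_polyN mulrC mul_polyC.
    rewrite (leq_trans (size_scale_leq _ _)) ?size_polyX // andbT.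
    by rewrite -polyC_natr (leq_trans (size_polyC_leq1 _)).
have -> : (exc_poly g)%:F = \det (res_mx (drsubmx g)) :> F.
  by rewrite res_mxE det_map_mx.
rewrite -det_map_mx /U map_block_mx map_mxN map_mxZ /= !PE -res_mxE.
pose b := C (ursubmx g); pose R := res_mx (drsubmx g); pose c := C (dlsubmx g).
have -> : block_mx (C (ulsubmx g)) b (- ('l *: c)) R =
    block_mx 1%:M (b *m invmx R) 0 1%:M *m block_mx (char_fun g) 0 (- ('l *: c)) R.
  rewrite mulmx_block !(mul1mx, mul0mx, mulmx0, add0r) mulmxKV ?res_mx_unit //.
  by rewrite char_funE -/b -/c -/R mulmxN -scalemxAr addrK.
by rewrite det_mulmx det_ublock !det1 !mul1r det_lblock.
Qed.

Lemma den_det_char_fun alpha N (g : 'M[K]_(alpha + N)) x :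
  (den_mult (\det (char_fun g)) x <= exc_div g x)%N.
Proof.
have [u su uE] := det_char_fun g.
have [rs /exc_polyE pE] := char_poly_roots (drsubmx g).
have p0 : exc_poly g != 0 by rewrite pE exc_prod_neq0.
have dE : \det (char_fun g) = u%:F / (exc_poly g)%:F.
  by rewrite uE mulfK // tofrac_eq0.
have [u0|u0] := eqVneq u 0.
  by rewrite dE u0 tofrac0 mul0r /den_mult eqxx.
rewrite dE den_multE //; case: x => [a|] /=; first exact: leq_subr.
apply: leq_sub2r; by move: su; case: (size u).
Qed.

(** Selecting rows and columns of chi leaves d unchanged, so the bound for determinants carries over
    to minors. *)
Lemma char_fun_mxsub alpha N (g : 'M[K]_(alpha + N)) k (r c : 'I_k -> 'I_alpha) :
  mxsub r c (char_fun g) = char_fun (block_mx (mxsub r c (ulsubmx g))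
    (rowsub r (ursubmx g)) (colsub c (dlsubmx g)) (drsubmx g)).
Proof.
rewrite !char_funE !(block_mxKul, block_mxKur, block_mxKdl, block_mxKdr).
apply/matrixP => i j; rewrite !mxE; congr (_ + _ * _).
apply: eq_bigr => s _; rewrite !mxE; congr (_ * _).
by apply: eq_bigr => t _; rewrite !mxE.
Qed.

Lemma den_minor_char_fun alpha N (g : 'M[K]_(alpha + N)) k (r c : 'I_k -> 'I_alpha) x :
  (den_mult (\det (mxsub r c (char_fun g))) x <= exc_div g x)%N.
Proof.
rewrite char_fun_mxsub (leq_trans (den_det_char_fun _ _)) //.
by case: x => [a|]; rewrite /exc_div /exc_poly block_mxKdr.
Qed.

End MinorBound.

(** * Realization *)

Lemma frac_clear (L : fieldType) (p n w d s t : L) : d != 0 -> s != 0 -> t != 0 ->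
  p * n * t = w * d -> p / s * (n / d) = w / (s * t).
Proof.
move=> d0 s0 t0 E; rewrite mulf_div; apply/eqP; rewrite eqr_div ?mulf_neq0 //.
by rewrite mulrCA E mulrCA.
Qed.

(** * Polynomials in s = 1 / lambda *)

Section PolynomialsInInverse.
Variable K : closedFieldType.
Local Notation F := (ratfun K).
Local Notation "'l" := (rat_lambda K).

(** Embeds K[s] in K(lambda) by s = 1 / lambda: poles occur only at lambda = 0, and lambda =
    infinity becomes the finite point s = 0. *)
Definition inv_poly : {poly K} -> F :=
  horner_eval ('l^-1) \o map_poly (@rat_const K).
HB.instance Definition _ :=
  GRing.RMorphism.copy inv_poly (horner_eval ('l^-1) \o map_poly (@rat_const K)).

Lemma inv_polyC c : inv_poly c%:P = rat_const c.
Proof. by rewrite /inv_poly /= map_polyC /horner_eval hornerC. Qed.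

Lemma inv_polyX : inv_poly 'X = 'l^-1.
Proof. by rewrite /inv_poly /= map_polyX /horner_eval hornerX. Qed.

Lemma inv_polyE p : inv_poly p = \sum_(i < size p) rat_const p`_i * 'l^-1 ^+ i.
Proof.
rewrite /inv_poly /= /horner_eval (@horner_coef_wide _ (size p)) ?size_poly //.
by apply: eq_bigr => i _; rewrite coef_map.
Qed.

Definition inv_integral (x : F) := exists p, x = inv_poly p.

Lemma inv_integral_poly p : inv_integral (inv_poly p). Proof. by exists p. Qed.

Lemma inv_integralD x y : inv_integral x -> inv_integral y -> inv_integral (x + y).
Proof. by move=> [p ->] [q ->]; exists (p + q); rewrite rmorphD. Qed.

Lemma inv_integralM x y : inv_integral x -> inv_integral y -> inv_integral (x * y).
Proof. by move=> [p ->] [q ->]; exists (p * q); rewrite rmorphM. Qed.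

Lemma inv_integralN x : inv_integral x -> inv_integral (- x).
Proof. by move=> [p ->]; exists (- p); rewrite rmorphN. Qed.

Lemma inv_integral0 : inv_integral 0. Proof. by exists 0; rewrite rmorph0. Qed.

Lemma inv_integral_frac (p : {poly K}) m :
  (size p <= m.+1)%N -> inv_integral (p%:F / 'l ^+ m).
Proof.
move=> pm; exists (\sum_(i < size p) (p`_i)%:P * 'X^(m - i)%N).
rewrite -{1}[p]coefK poly_def rmorph_sum [RHS]rmorph_sum mulr_suml.
apply: eq_bigr => i _; rewrite -mul_polyC !rmorphM !rmorphXn /= inv_polyC inv_polyX.
rewrite -/(rat_lambda K) -mulrA; congr (_ * _).
have im : (i <= m)%N by rewrite -ltnS (leq_trans _ pm).
rewrite -[X in _ / _ ^+ X](subnK im) exprD invfM mulrCA mulfV ?mulr1 ?exprVn //.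
by rewrite expf_neq0 // rat_lambda_neq0.
Qed.

(** A polynomial in s that vanishes at s = infinity is 0: multiplied by lambda to its degree, it has
    its leading coefficient as constant term. *)
Lemma inv_poly_strict p y : reg0 y -> inv_poly p = 'l * y -> p = 0.
Proof.
move=> ry pE; have [//|p0] := eqVneq p 0.
have sp : size p = (size p).-1.+1 by rewrite prednK // size_poly_gt0.
pose m := (size p).-1.
have rl k : reg0 ('l ^+ k) by rewrite /rat_lambda -tofracXn; apply: reg0_poly.
pose S := \sum_(i < m) rat_const p`_i * 'l ^+ (m - i.+1).
have E : 'l ^+ m * inv_poly p = rat_const (lead_coef p) + 'l * S.
  rewrite inv_polyE sp big_ord_recr /= -/m mulrDr addrC; congr (_ + _).
    by rewrite mulrCA -exprMn mulfV ?rat_lambda_neq0 // expr1n mulr1.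
  rewrite !mulr_sumr; apply: eq_bigr => i _.
  rewrite mulrCA [RHS]mulrCA -exprS subnSK //; congr (_ * _).
  rewrite -[X in 'l ^+ X * _](subnK (ltnW (ltn_ord i))) exprD -mulrA -exprMn.
  by rewrite mulfV ?rat_lambda_neq0 // expr1n mulr1.
have : rat_const (lead_coef p) + 'l * (S - 'l ^+ m * y) = 0.
  by rewrite mulrBr addrA -E pE mulrCA subrr.
move=> /reg0_const_eq0 => /(_ _)/eqP; rewrite lead_coef_eq0 => {}E; apply/eqP/E.
apply: reg0B; last exact: reg0M.
by apply: reg0_sum => i _; apply: reg0M; first exact: reg0_const.
Qed.

Lemma inv_poly_inj : injective inv_poly.
Proof.
move=> p q pq; apply/eqP; rewrite -subr_eq0; apply/eqP.
apply: (@inv_poly_strict _ 0); first by rewrite -tofrac0; apply: reg0_poly.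
by rewrite rmorphB /= pq subrr mulr0.
Qed.

Lemma inv_poly_eq0 p : (inv_poly p == 0) = (p == 0).
Proof. by rewrite -(inj_eq inv_poly_inj) rmorph0. Qed.

Lemma inv_integral_reg0 x : inv_integral x -> forall y, reg0 y -> x = 'l * y -> x = 0.
Proof. by move=> [p ->] y ry /(inv_poly_strict ry) ->; rewrite rmorph0. Qed.

Lemma inv_poly_prod (rs : seq K) :
  inv_poly (\prod_(r <- rs) ('X - r%:P)) = (exc_prod rs)%:F / 'l ^+ size rs.
Proof.
rewrite /exc_prod !rmorph_prod; elim: rs => [|r rs IHrs].
  by rewrite !big_nil divr1.
rewrite !big_cons IHrs /= exprS invfM mulrACA; congr (_ * _).
rewrite rmorphB /= inv_polyX inv_polyC tofracB tofracM mulrBl tofrac1 mul1r.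
congr (_ - _).
by rewrite mulfK // rat_lambda_neq0.
Qed.

Lemma inv_integral_local (rs : seq K) (x : F) :
  (forall a : K, a != 0 -> (den_mult x (Some a) <= count_mem a^-1 rs)%N) ->
  (den_mult x None <= count_mem 0%R rs)%N ->
  inv_integral (inv_poly (\prod_(r <- rs) ('X - r%:P)) * x).
Proof.
rewrite inv_poly_prod.
have [-> _ _|x0] := eqVneq x 0; first by rewrite mulr0; apply: inv_integral0.
have xE := frac_reprE x; set n := \n_(repr x) in xE; set d := \d_(repr x) in xE.
have d0 : d != 0 by exact: denom_ratioP.
have n0 : n != 0 by apply: contraNneq x0 => n0; rewrite xE n0 tofrac0 mul0r.
rewrite xE => fin; rewrite den_multE // => inf.
have {}fin a : a != 0 -> (mup a d - mup a n <= count_mem a^-1 rs)%N.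
  by move=> a0; have := fin a a0; rewrite den_multE.
pose p := exc_prod rs; have p0 : p != 0 := exc_prod_neq0 rs.
(* The pole at lambda = 0, that is s = infinity, is unrestricted; it goes into the power of lambda
   in the denominator. *)
pose j := mup 0 d.
have pn0 : p * n * 'X^j != 0 by rewrite !mulf_neq0 // expf_neq0 // polyX_eq0.
have /dvdpP [w wE] : d %| p * n * 'X^j.
  apply: dvdp_mup => // a; rewrite !mupM ?mulf_neq0 ?expf_neq0 ?polyX_eq0 // mup_exc_prod.
  have := mup_XsubCX j a 0; rewrite subr0 eq_sym => ->.
  case: eqP => [->|/eqP a0]; first by rewrite leq_addl.
  by have := fin a a0; rewrite addn0 addnC; lia.
have -> : p%:F / 'l ^+ size rs * (n%:F / d%:F) = w%:F / 'l ^+ (size rs + j).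
  rewrite exprD; apply: frac_clear; rewrite ?expf_neq0 ?rat_lambda_neq0 ?tofrac_eq0 //.
  by rewrite /rat_lambda -tofracXn -!tofracM wE.
apply: inv_integral_frac.
have w0 : w != 0 by apply: contraNneq pn0 => w0; rewrite wE w0 mul0r.
have := congr1 (fun q : {poly K} => size q) wE.
rewrite !size_mul ?mulf_neq0 ?expf_neq0 ?polyX_eq0 // size_polyXn.
have := size_exc_prod rs; rewrite -/p; move: inf (count_size (pred1 0) rs).
move: w0 d0 n0 p0; rewrite -!size_poly_gt0.
move: (size w) (size d) (size n) (size p) (size rs) (count_mem _ rs).
by move=> [|?] [|?] [|?] [|?] ? ? //=; lia.
Qed.

End PolynomialsInInverse.

(** Cauchy-Binet before grouping: the sum runs over all maps f, those with repeated columns giving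
    minors equal to 0. *)
Lemma det_mulmx_expand (R : comNzRingType) n m (A : 'M[R]_(n, m)) (B : 'M[R]_(m, n)) :
  \det (A *m B) = \sum_(f : {ffun 'I_n -> 'I_m}) \det (colsub f A) * \prod_i B (f i) i.
Proof.
rewrite -det_tr /determinant.
under eq_bigr => s _.
  under eq_bigr => i _ do rewrite 2!mxE.
  rewrite bigA_distr_bigA mulr_sumr.
  over.
rewrite exchange_big; apply: eq_bigr => f _ /=.
rewrite -/(determinant _) -[in RHS]det_tr /determinant mulr_suml; apply: eq_bigr => s _.
rewrite big_split /= -mulrA; congr (_ * (_ * _)).
by apply: eq_bigr => i _; rewrite !mxE.
Qed.

(** The matrix determinant lemma: both sides compute the determinant of one block matrix, by two
    triangular factorizations. *)
Lemma det_1Dcol_row (R : comNzRingType) n (w : 'cV[R]_n) (v : 'rV[R]_n) :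
  \det (1%:M + w *m v) = 1 + (v *m w) 0 0.
Proof.
have E1 : \det (block_mx 1%:M (- w) v 1%:M) = \det (1%:M + w *m v).
  have -> : block_mx 1%:M (- w) v 1%:M =
      block_mx (1%:M + w *m v) (- w) 0 1%:M *m block_mx 1%:M 0 v (1%:M : 'M_1).
    rewrite mulmx_block !(mul1mx, mulmx1, mul0mx, mulmx0, addr0, add0r).
    by rewrite mulNmx addrK.
  by rewrite det_mulmx det_ublock det_lblock !det1 !mulr1.
rewrite -E1.
have -> : block_mx 1%:M (- w) v 1%:M =
    block_mx 1%:M 0 v 1%:M *m block_mx 1%:M (- w) 0 (1%:M + v *m w).
  rewrite mulmx_block !(mul1mx, mulmx1, mul0mx, mulmx0, addr0, add0r).
  by rewrite mulmxN addrC addrK.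
by rewrite det_mulmx det_ublock det_lblock !det1 !mul1r det_mx11 !mxE.
Qed.

Section Minors.
Variables (R : comNzRingType) (alpha : nat) (chi : 'M[R]_alpha) (Q : R -> Prop).
Hypotheses (Q0 : Q 0) (QD : forall x y, Q x -> Q y -> Q (x + y))
  (QN : forall x, Q x -> Q (- x)).
Hypothesis Qminor : forall k (r c : 'I_k -> 'I_alpha),
  (k <= alpha)%N -> Q (\det (mxsub r c chi)).

(* Laplace expansion along the columns coming from the identity matrix. *)
Lemma augmented_minors k (r : 'I_k -> 'I_alpha) (f : 'I_k -> 'I_(alpha + alpha)) :
  (k <= alpha)%N -> Q (\det (mxsub r f (row_mx 1%:M chi))).
Proof.
elim: k r f => [|k IHk] r f ka.
  by have := @Qminor 0 r r ka; rewrite !det_mx00.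
have [/existsP [j /existsP [c /eqP fj]]|] :=
    boolP [exists j, [exists c, f j == lshift alpha c]].
  rewrite (expand_det_col _ j); elim/big_ind: _ => // i _.
  rewrite [mxsub _ _ _ i j]mxE fj row_mxEl mxE /cofactor.
  have -> : row' i (col' j (mxsub r f (row_mx 1%:M chi))) =
      mxsub (r \o lift i) (f \o lift j) (row_mx 1%:M chi).
    by apply/matrixP => s t; rewrite !mxE.
  have := IHk (r \o lift i) (f \o lift j) (ltnW ka); move: (\det _) => D QD'.
  have {}QD' : Q ((-1) ^+ (i + j) * D).
    by rewrite -signr_odd mulr_sign; case: odd => //; apply: QN.
  by case: (r i == _); rewrite ?mul1r ?mul0r.
rewrite negb_exists => /forallP nf.
have cP j : exists c, f j = rshift alpha c.
  case: (split_ordP (f j)) => c fj; last by exists c.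
  by have := nf j; rewrite negb_exists => /forallP /(_ c); rewrite fj eqxx.
have [c cE] := choice cP.
rewrite (_ : mxsub r f _ = mxsub r c chi); first exact: Qminor.
by apply/matrixP => s t; rewrite mxE cE row_mxEr mxE.
Qed.

(** By Cauchy-Binet the determinant is a combination of minors of (1, chi), which reduce to minors
    of chi. *)
Lemma lattice_minors (C1 C2 : 'M[R]_alpha) :
  (forall x i j, Q x -> Q (x * C1 i j)) -> (forall x i j, Q x -> Q (x * C2 i j)) ->
  Q (\det (C1 + chi *m C2)).
Proof.
move=> QC1 QC2.
have -> : C1 + chi *m C2 = row_mx 1%:M chi *m col_mx C1 C2 by rewrite mul_row_col mul1mx.
rewrite det_mulmx_expand; elim/big_ind: _ => // f _.
have : Q (\det (colsub f (row_mx 1%:M chi))) by apply: augmented_minors.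
move: (\det _) => D QD'; apply: (big_rec (fun z => Q (D * z))); first by rewrite mulr1.
move=> i z _ Qz; rewrite [_ * z]mulrC mulrA.
by case: (split_ordP (f i)) => j ->; rewrite ?col_mxEu ?col_mxEd; [apply: QC1|apply: QC2].
Qed.

End Minors.

Section Realization.
Variables (K : closedFieldType) (alpha : nat).
Local Notation F := (ratfun K).
Local Notation "'l" := (rat_lambda K).
Local Notation C := (map_mx (@rat_const K)).
Local Notation I := (map_mx (@inv_poly K)).

Definition inv_integral_mx m n (A : 'M[F]_(m, n)) := exists B, A = I B.

Lemma inv_integral_mxP m n (A : 'M[F]_(m, n)) :
  (forall i j, inv_integral (A i j)) -> inv_integral_mx A.
Proof.
move=> iA; have [B BE] := choice (fun ij => iA ij.1 ij.2).
exists (\matrix_(i, j) B (i, j)); apply/matrixP => i j.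
by rewrite !mxE (BE (i, j)).
Qed.

Lemma inv_mx_const m n (A : 'M[K]_(m, n)) : I (map_mx polyC A) = C A.
Proof. by apply/matrixP => i j; rewrite !mxE inv_polyC. Qed.

Lemma inv_integral_denominator (x : F) :
  exists ts : seq K, inv_integral (inv_poly (\prod_(t <- ts) ('X - t%:P)) * x).
Proof.
have := denom_ratioP (repr x); have := frac_reprE x.
move: (\n_(repr x)) (\d_(repr x)) => n d -> d0.
pose m := maxn (size n) (size d).
have [|p pE] := @inv_integral_frac K n m; first by rewrite leqW // leq_maxl.
have [|q qE] := @inv_integral_frac K d m; first by rewrite leqW // leq_maxr.
have l0 : 'l ^+ m != 0 by rewrite expf_neq0 // rat_lambda_neq0.
have q0 : q != 0.
  rewrite -inv_poly_eq0 -qE; apply: mulf_neq0; last by rewrite invr_eq0.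
  by rewrite tofrac_eq0.
have [ts tsE] := closed_field_poly_normal q; exists ts.
have lc0 : rat_const (lead_coef q) != 0 by rewrite fmorph_eq0 lead_coef_eq0.
exists ((lead_coef q)^-1%:P * p); rewrite rmorphM /= inv_polyC fmorphV.
apply: (mulfI lc0); rewrite mulVKf // mulrA -inv_polyC -rmorphM mul_polyC -tsE /= -qE -pE.
by rewrite mulrC mulrA divfK ?tofrac_eq0.
Qed.

Lemma col_denominator (w : 'cV[F]_alpha) :
  exists ts : seq K, inv_integral_mx (inv_poly (\prod_(t <- ts) ('X - t%:P)) *: w).
Proof.
have [ts tsE] := choice (fun i => inv_integral_denominator (w i 0)).
exists (flatten [seq ts i | i <- enum 'I_alpha]).
apply: inv_integral_mxP => i j; rewrite ord1 mxE big_flatten big_map.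
rewrite (perm_big _ (perm_to_rem (mem_enum _ i))) big_cons rmorphM /= mulrAC mulrC.
by apply: inv_integralM => //; apply: inv_integral_poly.
Qed.

(** When the factors of a common denominator are dropped one at a time, integrality is lost at some
    step; just there the vector has a simple pole s0. *)
Lemma minimal_denominator (w : 'cV[F]_alpha) : ~ inv_integral_mx w ->
  exists t s0, ~ inv_integral_mx (inv_poly t *: w) /\
    inv_integral_mx (inv_poly ('X - s0%:P) *: (inv_poly t *: w)).
Proof.
move=> nw; have [ts] := col_denominator w.
elim: ts => [|t ts IHts]; first by rewrite big_nil rmorph1 scale1r.
rewrite big_cons rmorphM -scalerA => tw.
have [//|nts] := pselect (inv_integral_mx (inv_poly (\prod_(t <- ts) ('X - t%:P)) *: w)).
by exists (\prod_(t <- ts) ('X - t%:P)), t.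
Qed.

(** Eigenvalues that leave no trace in chi are realized by decoupled states. *)
Lemma realize_const (a : 'M[K]_alpha) (rs : seq K) :
  exists N (g : 'M[K]_(alpha + N)),
    char_fun g = C a /\ char_poly (drsubmx g) = \prod_(r <- rs) ('X - r%:P).
Proof.
elim: rs => [|r rs [N [g [gE cE]]]].
  exists 0%N, (block_mx a 0 0 0); rewrite char_funE !(block_mxKul, block_mxKur).
  by rewrite !map_mx0 !mul0mx scaler0 addr0 big_nil /char_poly det_mx00.
exists (1 + N)%N, (coll_mul (diag1 alpha r) g).
rewrite char_fun_mul char_fun_diag1 mul1mx gE; split=> //.
by rewrite char_poly_coll_mul char_poly_diag1 cE big_cons.
Qed.

Lemma char_fun_addl (a : 'M[K]_alpha) N (g : 'M[K]_(alpha + N)) :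
  char_fun (block_mx (a + ulsubmx g) (ursubmx g) (dlsubmx g) (drsubmx g)) =
  C a + char_fun g.
Proof.
rewrite !char_funE !(block_mxKul, block_mxKur, block_mxKdl, block_mxKdr).
by rewrite map_mxD addrA.
Qed.

End Realization.

Section Realization.
Variables (K : closedFieldType) (alpha : nat).
Local Notation F := (ratfun K).
Local Notation "'l" := (rat_lambda K).
Local Notation C := (map_mx (@rat_const K)).
Local Notation I := (map_mx (@inv_poly K)).

Lemma det_proj_add (w v : 'M[F]_alpha) (c : 'cV[F]_alpha) (r : 'rV[F]_alpha) (x : F) :
  r *m c = 1%:M -> \det (1%:M + (x - 1) *: (c *m r)) = x.
Proof.
move=> rc; rewrite scalemxAl det_1Dcol_row -scalemxAr rc !mxE eqxx mulr1.
by rewrite addrC subrK.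
Qed.

Lemma proj_add_inv (c : 'cV[F]_alpha) (r : 'rV[F]_alpha) (x : F) : x != 0 ->
  r *m c = 1%:M ->
  (1%:M + (x - 1) *: (c *m r)) *m (1%:M + (x^-1 - 1) *: (c *m r)) = 1%:M.
Proof.
move=> x0 rc; have pp : (c *m r) *m (c *m r) = c *m r.
  by rewrite mulmxA -[c *m r *m c]mulmxA rc mulmx1.
rewrite mulmxDl mul1mx mulmxDr mulmx1 -scalemxAl -scalemxAr pp scalerA.
rewrite -[RHS]addr0 -!addrA; congr (_ + _); rewrite -!scalerDl.
have -> : x^-1 - 1 + (x - 1 + (x - 1) * (x^-1 - 1)) = 0.
  by rewrite mulrBl mul1r mulrBr mulfV // mulr1; ring.
by rewrite scale0r.
Qed.

Lemma factor_out (U : 'cV[{poly K}]_alpha) s0 :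
  exists V, U = map_mx polyC (map_mx (horner_eval s0) U) + ('X - s0%:P) *: V.
Proof.
have fac i : exists q, U i 0 = (U i 0).[s0]%:P + ('X - s0%:P) * q.
  have /factor_theorem [q qE] : root (U i 0 - (U i 0).[s0]%:P) s0.
    by rewrite /root !hornerE subrr.
  by exists q; rewrite mulrC -qE addrC subrK.
have [q qE] := choice fac; exists (\col_i q i).
by apply/matrixP => i j; rewrite ord1 !mxE /horner_eval -qE.
Qed.

(** With s = 1 / lambda, the factor lambda / (1 - lambda s0) is 1 / (s - s0). *)
Lemma char_fun_elementary (c : 'cV[K]_alpha) (r : 'rV[K]_alpha) s0 :
  char_fun (block_mx (1%:M - c *m r) c r s0%:M : 'M[K]_(alpha + 1)) =
  1%:M + ((inv_poly ('X - s0%:P))^-1 - 1) *: (C c *m C r).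
Proof.
rewrite char_funE !(block_mxKul, block_mxKur, block_mxKdl, block_mxKdr).
have l0 := rat_lambda_neq0 K.
have sE : inv_poly ('X - s0%:P) = 'l^-1 * (1 - 'l * rat_const s0).
  by rewrite rmorphB /= inv_polyX inv_polyC mulrBr mulr1 mulKf.
have -> : res_mx s0%:M = (1 - 'l * rat_const s0)%:M :> 'M_1.
  by rewrite /res_mx map_scalar_mx scale_scalar_mx raddfB.
rewrite invmx_scalar mul_mx_scalar -scalemxAl scalerA sE invfM invrK.
by rewrite scalerBl scale1r map_mxB map_mx1 map_mxM -addrA [- _ + _]addrC.
Qed.

(** The second hypothesis makes the product of the s - r a common denominator for determinants of
    vectors in the lattice of chi; in this form it passes to [E *m chi0] by a change of lattice. *)
Lemma realize (rs : seq K) (chi : 'M[F]_alpha) :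
  (forall i j, reg0 (chi i j)) ->
  (forall C1 C2 : 'M[{poly K}]_alpha,
     inv_integral (inv_poly (\prod_(r <- rs) ('X - r%:P)) * \det (I C1 + chi *m I C2))) ->
  exists N (g : 'M[K]_(alpha + N)),
    char_fun g = chi /\ char_poly (drsubmx g) = \prod_(r <- rs) ('X - r%:P).
Proof.
have [m] := ubnP (size rs); elim: m => // m IHm in rs chi *; rewrite ltnS => srs rchi H.
have [a0 aP] := choice (fun ij => reg0_split (rchi ij.1 ij.2)).
have [Y0 YP] := choice aP.
pose a : 'M[K]_alpha := \matrix_(i, j) a0 (i, j).
pose Y : 'M[F]_alpha := \matrix_(i, j) Y0 (i, j).
have rY i j : reg0 (Y i j) by rewrite mxE; have [] := YP (i, j).
have chiE : chi = C a + 'l *: Y.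
  by apply/matrixP => i j; rewrite !mxE; have [_ /= ->] := YP (i, j).
(* Subtracting the value at lambda = 0 keeps the lattice, and makes chi0 vanish as soon as it is
   polynomial in s. *)
set chi0 := 'l *: Y in chiE.
suff [N [g [gE cE]]] : exists N (g : 'M[K]_(alpha + N)),
    char_fun g = chi0 /\ char_poly (drsubmx g) = \prod_(r <- rs) ('X - r%:P).
  exists N, (block_mx (a + ulsubmx g) (ursubmx g) (dlsubmx g) (drsubmx g)).
  by rewrite char_fun_addl block_mxKdr gE -chiE.
have H0 (C1 C2 : 'M[{poly K}]_alpha) :
    inv_integral (inv_poly (\prod_(r <- rs) ('X - r%:P)) * \det (I C1 + chi0 *m I C2)).
  have := H (C1 - map_mx polyC a *m C2) C2; congr inv_integral; congr (_ * \det _).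
  rewrite map_mxB map_mxM inv_mx_const chiE mulmxDl addrA; congr (_ + _).
  by rewrite subrK.
have [all_int|] := pselect (forall j, inv_integral_mx (col j chi0)).
  have -> : chi0 = C 0; last exact: realize_const.
  rewrite map_mx0; apply/matrixP => i j; have [B BE] := all_int j.
  have := congr1 (fun A : 'cV_alpha => A i 0) BE; rewrite [LHS]mxE [RHS]mxE => E.
  rewrite [RHS]mxE; apply: (inv_integral_reg0 _ (rY i j)); last by rewrite mxE.
  by rewrite E; apply: inv_integral_poly.
move=> /existsNP [j /minimal_denominator [t [s0 [nw [U UE]]]]].
set w := inv_poly t *: _ in nw UE; pose s := inv_poly ('X - s0%:P).
have sN0 : s != 0 by rewrite inv_poly_eq0 polyXsubC_eq0.
have [V UV] := factor_out U s0; set w0 := map_mx (horner_eval s0) U in UV.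
clearbody w0.
(* The principal part of w at its simple pole s0 lies in the lattice along with w. *)
have wE : s^-1 *: C w0 = w - I V.
  have := congr1 (fun A : 'cV_alpha => s^-1 *: A) UE.
  rewrite {1}UV map_mxD map_mxZ inv_mx_const scalerA mulVf // scale1r => ->.
  by rewrite scalerDr scalerA mulVf // scale1r addrK.
have w0N0 : w0 != 0.
  apply: contra_notN nw => /eqP w00; exists V; apply/eqP; rewrite -subr_eq0.
  by rewrite -wE w00 map_mx0 scaler0.
have /cV0Pn [i0 wi0] := w0N0.
pose v : 'rV[K]_alpha := (w0 i0 0)^-1 *: delta_mx 0 i0.
have vw : v *m w0 = 1%:M.
  rewrite /v -scalemxAl -rowE; apply/matrixP => ? ?; rewrite !ord1 !mxE eqxx.
  by rewrite mulVf.
have CvW : C v *m C w0 = 1%:M by rewrite -map_mxM vw map_mx1.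
clearbody v.
pose E := 1%:M + (s - 1) *: (C w0 *m C v).
pose E' := 1%:M + (s^-1 - 1) *: (C w0 *m C v).
have EE' : E *m E' = 1%:M by apply: proj_add_inv.
(* The columns of E' lie in the lattice spanned by those of 1 and chi0. *)
pose D1 := map_mx polyC (1%:M - w0 *m v) - V *m map_mx polyC v.
pose D2 : 'M_alpha := (t *: delta_mx j 0) *m map_mx polyC v.
have E'D : E' = I D1 + chi0 *m I D2.
  have wM : chi0 *m I (t *: delta_mx j 0) = w.
    by rewrite map_mxZ map_delta_mx -scalemxAr -colE.
  rewrite /D1 /D2 map_mxB !(map_mxM (@inv_poly K)) !inv_mx_const mulmxA wM.
  have -> : w = s^-1 *: C w0 + I V by rewrite wE subrK.
  rewrite mulmxDl [s^-1 *: _ *m _ + _]addrC addrA subrK -scalemxAl.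
  by rewrite map_mxB map_mx1 map_mxM /E' scalerBl scale1r -addrA [- _ + _]addrC.
clearbody D1 D2.
(* [E'] consists of lattice vectors and has determinant 1 / (s - s0), so s - s0 divides the product
   over rs. *)
have s0rs : s0 \in rs.
  have [p] := H0 D1 D2; rewrite -E'D det_proj_add // => pE.
  rewrite -root_prod_XsubC; apply/factor_theorem; exists p; apply: inv_poly_inj.
  by rewrite rmorphM /= -/s -pE mulrC mulrCA mulfV ?mulr1.
pose rs' := rem s0 rs.
have rsE : \prod_(r <- rs) ('X - r%:P) = ('X - s0%:P) * \prod_(r <- rs') ('X - r%:P).
  by rewrite (perm_big _ (perm_to_rem s0rs)) big_cons.
have [||C1 C2|N [g [gE cE]]] := IHm rs' (E *m chi0).
- apply: leq_trans srs; rewrite size_rem // ltn_predL.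
  by case: (rs) s0rs.
(* E has a simple pole at lambda = 0, coming from s, which the factor lambda of chi0 cancels. *)
- rewrite /chi0 -scalemxAr scalemxAl; apply: reg0_mulmx => // i k.
  have rl : reg0 'l by apply: reg0_poly.
  have r1 : reg0 (1 : F) by rewrite -(rmorph1 (@rat_const K)); apply: reg0_const.
  have -> : ('l *: E) i k =
      'l * (i == k)%:R + (1 - 'l * rat_const s0 - 'l) * C (w0 *m v) i k.
    have EE : E i k = (i == k)%:R + (s - 1) * C (w0 *m v) i k.
      by rewrite /E -map_mxM mxE [X in _ + X]mxE [X in X + _]mxE.
    rewrite mxE EE mulrDr mulrA.
    congr (_ + _ * _); rewrite mulrBr mulr1; congr (_ - _).
    by rewrite /s rmorphB /= inv_polyX inv_polyC mulrBr mulfV ?rat_lambda_neq0.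
  apply: reg0D; apply: reg0M.
  + exact: rl.
  + by rewrite -(rmorph_nat (@rat_const K)); apply: reg0_const.
  + apply: (reg0B _ rl); apply: (reg0B r1); apply: (reg0M rl).
    exact: reg0_const.
  + by rewrite mxE; apply: reg0_const.
(* The new lattice lies in the image of the old one under E, and the determinant s - s0 of E is the
   factor removed from rs. *)
- have -> : I C1 + E *m chi0 *m I C2 =
      E *m (I (D1 *m C1) + chi0 *m I (D2 *m C1 + C2)).
    rewrite map_mxD !(map_mxM (@inv_poly K)) [chi0 *m (_ + _)]mulmxDr addrA.
    rewrite [chi0 *m (I D2 *m _)]mulmxA -mulmxDl -E'D mulmxDr mulmxA EE' mul1mx.
    by rewrite mulmxA.
  rewrite det_mulmx det_proj_add // mulrA [_ * s]mulrC -rmorphM -rsE.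
  exact: H0.
pose h : 'M[K]_(alpha + 1) := block_mx (1%:M - w0 *m v) w0 v s0%:M.
exists (1 + N)%N, (coll_mul h g); rewrite char_fun_mul char_fun_elementary gE mulmxA.
rewrite -/s -/E' (mulmx1C EE') mul1mx; split=> //.
rewrite char_poly_coll_mul cE rsE block_mxKdr; congr (_ * _).
by rewrite /char_poly det_mx11 /char_poly_mx !mxE eqxx.
Qed.

End Realization.

(** * The isomorphism *)

Section Classes.
Variables (K : closedFieldType) (alpha : nat).
Local Notation add_pole := (@add_pole K alpha).

Lemma iter_coll_step i (z : coll_rep K alpha) :
  iter i (@coll_step K alpha) z = foldr add_pole z (nseq i 1).
Proof.
elim: i => //= i ->; have [N [g ->]] := coll_rep_of_surj (foldr add_pole z (nseq i 1)).
by rewrite coll_step_rep_of coll_emb_diag1 add_pole_rep_of.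
Qed.

(** The limit identifies a point with its embeddings, which only add eigenvalues 1. *)
Lemma coll_class_eqP N M (g : 'M[K]_(alpha + N)) (h : 'M[K]_(alpha + M)) :
  coll_class g = coll_class h <->
  [/\ ulsubmx g = ulsubmx h, forall k, moment g k = moment h k
    & exists i j,
        char_poly (drsubmx g) * \prod_(x <- nseq i 1) ('X - x%:P) =
        char_poly (drsubmx h) * \prod_(x <- nseq j 1) ('X - x%:P)].
Proof.
split=> [/eqmodP /coll_lim_relP [i [j]]|[a_eq m_eq [i [j c_eq]]]].
  rewrite !iter_coll_step -!/(coll_rep_of _).
  have [Ng [g' [-> ag mg cg]]] := foldr_add_pole_rep_of g (nseq i 1).
  have [Nh [h' [-> ah mh ch]]] := foldr_add_pole_rep_of h (nseq j 1).
  move=> /coll_rep_of_eqP [a_eq m_eq c_eq]; split=> [|k|].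
  - by rewrite -ag -ah.
  - by rewrite -mg -mh.
  - by exists i, j; rewrite -cg -ch.
apply/eqmodP/coll_lim_relP; exists i, j; rewrite !iter_coll_step -!/(coll_rep_of _).
have [Ng [g' [-> ag mg cg]]] := foldr_add_pole_rep_of g (nseq i 1).
have [Nh [h' [-> ah mh ch]]] := foldr_add_pole_rep_of h (nseq j 1).
apply: coll_rep_of_eq => [|k|]; first by rewrite ag ah.
  by rewrite mg mh.
by rewrite cg ch.
Qed.

Lemma coll_divE N (g : 'M[K]_(alpha + N)) rs x :
  char_poly (drsubmx g) = \prod_(r <- rs) ('X - r%:P) ->
  coll_div g x = if x == Some 1 then None
    else if x == Some 0 then Some 0%N else Some (count_mem (pole_inv x) rs).
Proof.
by move=> rsE; rewrite /coll_div (exc_divE x rsE); case: eqP => // _; case: eqP.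
Qed.

Definition pole_pt (r : K) : proj_line K := if r == 0 then None else Some r^-1.

Lemma pole_ptK r : pole_inv (pole_pt r) = r.
Proof. by rewrite /pole_pt; case: eqP => [->|_] //=; rewrite invrK. Qed.

Lemma pole_pt_eq1 r : (pole_pt r == Some 1) = (r == 1).
Proof.
rewrite /pole_pt; have [->|r0] := eqVneq r 0; first by rewrite [RHS]eq_sym oner_eq0.
by rewrite -[RHS](inj_eq invr_inj) invr1.
Qed.

Lemma pole_pt_neq0 r : (pole_pt r == Some 0) = false.
Proof.
rewrite /pole_pt; case: (eqVneq r 0) => // r0; apply/eqP => -[/eqP].
by rewrite invr_eq0 (negPf r0).
Qed.

Lemma pole_invK (x : proj_line K) : x != Some 0 -> pole_pt (pole_inv x) = x.
Proof.
case: x => [a|] a0; rewrite /pole_pt /= ?eqxx //.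
have {}a0 : a != 0 by apply: contraNneq a0 => ->.
by rewrite invr_eq0 (negPf a0) invrK.
Qed.

Lemma coll_div_eqP N M (g : 'M[K]_(alpha + N)) (h : 'M[K]_(alpha + M)) :
  coll_div g = coll_div h <-> exists i j,
    char_poly (drsubmx g) * \prod_(x <- nseq i 1) ('X - x%:P) =
    char_poly (drsubmx h) * \prod_(x <- nseq j 1) ('X - x%:P).
Proof.
have [rs rsE] := char_poly_roots (drsubmx g).
have [ts tsE] := char_poly_roots (drsubmx h).
split=> [div_eq|[i [j]]].
  (* Padding each side with as many 1 as the other has balances the eigenvalue 1; at the other
     eigenvalues the divisors agree. *)
  exists (count_mem 1 ts), (count_mem 1 rs); rewrite rsE tsE -!big_cat.
  apply/perm_big/allP => r _ /=; rewrite !count_cat !count_nseq /=.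
  have := congr1 (fun xi => xi (pole_pt r)) div_eq.
  rewrite (coll_divE _ rsE) (coll_divE _ tsE) pole_pt_eq1 pole_pt_neq0 pole_ptK.
  case: (eqVneq r 1) => [->|r1] E; first by rewrite ?eqxx !mul1n addnC.
  by rewrite !mul0n !addn0; case: E => ->.
rewrite rsE tsE -!big_cat => /prod_XsubC_eq /seq.permP E; apply/funext => x.
rewrite (coll_divE _ rsE) (coll_divE _ tsE).
case: eqP => // /eqP x1; case: eqP => // /eqP x0.
have := E (pred1 (pole_inv x)); rewrite !count_cat !count_nseq /=.
have -> : (1 == pole_inv x) = false.
  by apply/negbTE; rewrite eq_sym -pole_pt_eq1 pole_invK.
by rewrite !mul0n !addn0 => ->.
Qed.

Lemma coll_class_eq_char N M (g : 'M[K]_(alpha + N)) (h : 'M[K]_(alpha + M)) :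
  coll_class g = coll_class h <-> char_fun g = char_fun h /\ coll_div g = coll_div h.
Proof.
rewrite coll_class_eqP coll_div_eqP.
split=> [[a_eq m_eq c_eq]|[/char_fun_inj [a_eq m_eq] c_eq]] //.
by split=> //; apply: eq_char_fun.
Qed.

Lemma coll_div_mul N M (g : 'M[K]_(alpha + N)) (h : 'M[K]_(alpha + M)) :
  coll_div (coll_mul g h) = div_add (coll_div g) (coll_div h).
Proof.
have [rs rsE] := char_poly_roots (drsubmx g).
have [ts tsE] := char_poly_roots (drsubmx h).
apply/funext => x; rewrite /div_add (coll_divE _ rsE) (coll_divE _ tsE).
rewrite (@coll_divE _ _ (rs ++ ts)); last by rewrite char_poly_coll_mul rsE tsE big_cat.
by case: eqP => // _; case: eqP => // _; rewrite count_cat.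
Qed.

Lemma coll_lim_repr (x : coll_lim K alpha) :
  exists N (g : 'M[K]_(alpha + N)), repr x = coll_rep_of g /\ x = coll_class g.
Proof.
have [N [g gE]] := coll_rep_of_surj (repr x); exists N, g; split=> //.
by rewrite /coll_class /coll_lim_in -/(coll_rep_of g) -gE reprK.
Qed.

Lemma coll_lim_mulE (x y : coll_lim K alpha) N M
    (g : 'M_(alpha + N)) (h : 'M_(alpha + M)) :
  repr x = coll_rep_of g -> repr y = coll_rep_of h ->
  coll_lim_mul x y = coll_class (coll_mul g h).
Proof.
rewrite /coll_lim_mul => -> ->; rewrite /coll_class; congr coll_lim_in.
exact/coll_quot_eq/coll_quot_mul_point.
Qed.

Lemma R_alpha_char_fun N (g : 'M[K]_(alpha + N)) : R_alpha (char_fun g) (coll_div g).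
Proof.
have [rs rsE] := char_poly_roots (drsubmx g); split.
- move=> i j; apply/eqP; rewrite -leqn0.
  have := den_minor_char_fun g (fun _ : 'I_1 => i) (fun=> j) (Some 0).
  by rewrite det_mx11 mxE (exc_divE _ rsE) eqxx.
- split=> [||x x1]; last 2 first.
  + by rewrite /coll_div eqxx.
  + by rewrite /coll_div (negPf x1).
  exists [:: Some 1, None & [seq pole_pt r | r <- rs]] => x.
  rewrite !inE !negb_or => /and3P [x1 xN xrs]; rewrite (coll_divE _ rsE) (negPf x1).
  case: eqP => // /eqP x0; congr Some; apply/count_memPn.
  by apply: contra xrs => /(map_f pole_pt); rewrite pole_invK.
- by rewrite (coll_divE _ rsE) eqxx; case: eqP => // -[] /eqP; rewrite eq_sym oner_eq0.
- move=> k r c x; rewrite /coll_div; case: eqP => // _.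
  exact: den_minor_char_fun.
Qed.

Lemma reg0_den_mult (x : ratfun K) : den_mult x (Some 0) = 0%N -> reg0 x.
Proof.
have [-> _|x0] := eqVneq x 0; first by rewrite -tofrac0; apply: reg0_poly.
move: x0; have := denom_ratioP (repr x); have := frac_reprE x.
move: (\n_(repr x)) (\d_(repr x)) => n d -> d0 x0.
have n0 : n != 0 by apply: contraNneq x0 => ->; rewrite tofrac0 mul0r.
rewrite den_multE // => /eqP; rewrite subn_eq0.
have [i [p pN nE]] := multiplicity_XsubC n 0.
have [j [q qN dE]] := multiplicity_XsubC d 0.
have {}pN := implyP pN n0; have {}qN := implyP qN d0.
rewrite nE dE !mupMr // !mup_XsubCX eqxx => ji.
exists (p * ('X - 0%:P) ^+ (i - j)), q; split; first exact: qN.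
have q0 : q != 0 by apply: contraNneq qN => ->; rewrite root0.
have XN0 : ('X - (0 : K)%:P) ^+ j != 0 by rewrite expf_neq0 // polyXsubC_eq0.
have q0F : q%:F != 0 :> ratfun K by rewrite tofrac_eq0.
have qXF : (q * ('X - 0%:P) ^+ j)%:F != 0 :> ratfun K by rewrite tofrac_eq0 mulf_neq0.
apply/eqP; rewrite (eqr_div _ _ qXF q0F).
rewrite -[X in X == _]tofracM -[X in _ == X]tofracM tofrac_eq.
rewrite -{1}(subnK ji) exprD; apply/eqP; ring.
Qed.

Section PoleList.
Variables (mu : proj_line K -> nat) (s : seq (proj_line K)).
Hypotheses (mu0 : mu (Some 0) = 0%N) (mus : forall x, x \notin s -> mu x = 0%N).

Definition pole_list := flatten [seq nseq (mu x) (pole_inv x) | x <- undup s].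

Lemma count_pole_list x : x != Some 0 -> count_mem (pole_inv x) pole_list = mu x.
Proof.
move=> x0; rewrite /pole_list count_flatten -map_comp sumnE big_map.
have E y : count_mem (pole_inv x) (nseq (mu y) (pole_inv y)) =
    if y == x then mu x else 0%N.
  rewrite count_nseq /=; have [->|y0] := eqVneq y (Some 0).
    by rewrite mu0 muln0; case: eqP => // <-.
  have [->|yx] := eqVneq y x; first by rewrite eqxx mul1n.
  case: eqP => // yx'; case/eqP: yx.
  by rewrite -(pole_invK y0) yx' pole_invK.
under eq_bigr => y _ do rewrite /= E.
rewrite -big_mkcond /=; have [xs|/mus ->] := boolP (x \in s); last by rewrite big1.
by rewrite -big_filter filter_pred1_uniq ?undup_uniq ?mem_undup // big_seq1.
Qed.

End PoleList.

Lemma R_alpha_realize (chi : 'M[ratfun K]_alpha) (xi : divisor K) :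
  R_alpha chi xi -> exists N (g : 'M[K]_(alpha + N)), char_fun g = chi /\ coll_div g = xi.
Proof.
move=> [Gchi [[s xis] xi1 xiN] xi0 minors].
(* Xi is infinite at lambda = 1, so a finite multiplicity of the eigenvalue 1 has to be chosen: the
   largest pole order at 1 among the minors of chi. *)
pose m := \max_(k < alpha.+1) \max_(r : {ffun 'I_k -> 'I_alpha})
  \max_(c : {ffun 'I_k -> 'I_alpha}) den_mult (\det (mxsub r c chi)) (Some 1%R).
pose mu x := if x == Some 1 then m else odflt 0%N (xi x).
have xiE x : x != Some 1 -> xi x = Some (mu x).
  by move=> x1; rewrite /mu (negPf x1); have := xiN x x1; case: (xi x).
have mu0 : mu (Some 0) = 0%N.
  by rewrite /mu xi0; case: eqP => // -[] /eqP; rewrite eq_sym oner_eq0.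
have mus x : x \notin Some 1 :: s -> mu x = 0%N.
  by rewrite inE negb_or /mu => /andP [/negPf -> /xis ->].
pose rs := pole_list mu (Some 1 :: s).
have minor_mu k (r c : 'I_k -> 'I_alpha) x : (k <= alpha)%N ->
    (den_mult (\det (mxsub r c chi)) x <= mu x)%N.
  move=> ka; have [->|x1] := eqVneq x (Some 1); last first.
    by have := minors k r c x; rewrite xiE.
  rewrite /mu eqxx /m; pose k' : 'I_alpha.+1 := Ordinal (ka : (k < alpha.+1)%N).
  apply: leq_trans (leq_bigmax k'); apply: leq_trans (leq_bigmax [ffun i => r i]).
  apply: leq_trans (leq_bigmax [ffun i => c i]).
  rewrite (_ : mxsub r c chi = mxsub [ffun i => r i] [ffun i => c i] chi) //.
  by apply/matrixP => i j; rewrite !mxE !ffunE.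
have [||N [g [gE cE]]] := @realize K alpha rs chi.
- by move=> i j; apply: reg0_den_mult; apply: Gchi.
- move=> C1 C2; pose Q z := inv_integral (inv_poly (\prod_(r <- rs) ('X - r%:P)) * z).
  apply: (@lattice_minors _ _ chi Q).
  + by rewrite /Q mulr0; apply: inv_integral0.
  + by move=> x y Qx Qy; rewrite /Q mulrDr; apply: inv_integralD.
  + by move=> x Qx; rewrite /Q mulrN; apply: inv_integralN.
  + move=> k r c ka; apply: inv_integral_local => [a a0|].
      rewrite -[a^-1]/(pole_inv (Some a)) count_pole_list //; first exact: minor_mu.
    by rewrite -[0%R]/(pole_inv None) count_pole_list //; apply: minor_mu.
  + by move=> x i j Qx; rewrite /Q mulrA mxE; apply/inv_integralM/inv_integral_poly.
  + by move=> x i j Qx; rewrite /Q mulrA mxE; apply/inv_integralM/inv_integral_poly.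
exists N, g; split=> //; apply/funext => x; rewrite (coll_divE _ cE).
case: eqP => [->|/eqP x1]; first by rewrite xi1.
by case: eqP => [->|/eqP x0]; rewrite ?xi0 // xiE // count_pole_list.
Qed.

End Classes.

Theorem theorem2p10 (K : closedFieldType) (alpha : nat) :
  exists Phi : coll_lim K alpha -> 'M[ratfun K]_alpha * divisor K,
    [/\ forall (N : nat) (g : 'M[K]_(alpha + N)),
          Phi (coll_class g) = (char_fun g, coll_div g),
        forall x : coll_lim K alpha,
          exists (N : nat) (g : 'M[K]_(alpha + N)), x = coll_class g,
        forall x y : coll_lim K alpha,
          Phi (coll_lim_mul x y) =
          ((Phi x).1 *m (Phi y).1, div_add (Phi x).2 (Phi y).2),
        injective Phi
      & forall (chi : 'M[ratfun K]_alpha) (xi : divisor K),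
          R_alpha chi xi <-> exists x : coll_lim K alpha, Phi x = (chi, xi)].
Proof.
(* The product on the limit is computed on [repr], so the matrix chosen for x represents both
   [repr x] and the class x. *)
have [z zP] : exists z : coll_lim K alpha -> {N & 'M[K]_(alpha + N)},
    forall x, repr x = coll_rep_of (tagged (z x)) /\ x = coll_class (tagged (z x)).
  have ex x : exists z : {N & 'M[K]_(alpha + N)},
      repr x = coll_rep_of (tagged z) /\ x = coll_class (tagged z).
    by have [N [g gP]] := coll_lim_repr x; exists (existT _ N g).
  by have [z zP] := choice ex; exists z.
pose Phi x := (char_fun (tagged (z x)), coll_div (tagged (z x))).
have PhiE N (g : 'M[K]_(alpha + N)) : Phi (coll_class g) = (char_fun g, coll_div g).
  have [_ /coll_class_eq_char [gE dE]] := zP (coll_class g).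
  by rewrite /Phi -gE -dE.
exists Phi; split=> //.
- by move=> x; exists (tag (z x)), (tagged (z x)); have [] := zP x.
- move=> x y; have [rx _] := zP x; have [ry _] := zP y.
  by rewrite (coll_lim_mulE rx ry) PhiE char_fun_mul coll_div_mul.
- move=> x y [gE dE]; have [_ ->] := zP x; have [_ ->] := zP y.
  exact/coll_class_eq_char.
- move=> chi xi; split=> [/R_alpha_realize [N [g [<- <-]]]|[x [<- <-]]].
    by exists (coll_class g).
  exact: R_alpha_char_fun.
Qed.
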